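(* Let $\alpha\ge0$ and let $s$ be a real number such that $s>3\alpha+2$. Then for all nonzero $f\in L^2_\alpha(\mathbb{K})$ and all measurable subsets $E\subset\widehat{\mathbb{K}}$ such that $0<\gamma_\alpha(E)<+\infty$, $$\left\|\mathcal{F}_{LB}(f)\,\chi_E\right\|_{\gamma_\alpha,2}<M_{\alpha,s}\ \gamma_\alpha(E)^{\frac12}\ \|f\|_{\alpha,2}^{1-\frac{3\alpha+2}{s}}\ \big\|\,|(x,t)|^s f\,\big\|_{\alpha,2}^{\frac{3\alpha+2}{s}},$$ where $$M_{\alpha,s}=\left(\frac{B\left(\frac{\alpha+1}{2},\frac{2\alpha+1}{2}\right)B\left(\frac{s-3\alpha-2}{s},\frac{3\alpha+2}{s}\right)}{4^{\alpha+1}\pi\,\Gamma(\alpha+1)(s-3\alpha-2)}\left(\frac{s-3\alpha-2}{3\alpha+2}\right)^{\frac{3\alpha+2}{s}}\right)^{\frac12}$$ and $B$ is the Euler beta function. (The norm $\||(x,t)|^s f\|_{\alpha,2}$ may be infinite.)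
   Context: Fix $\alpha\ge 0$. Let $\mathbb{K}=[0,+\infty)\times[0,+\infty)$, with points $(x,t)$, and $\widehat{\mathbb{K}}=[0,+\infty)\times\mathbb{N}$ (with $0\in\mathbb{N}$), with points $(\lambda,m)$. $\chi_E$ is the indicator function of $E$. Measures and norms: $dm_\alpha(x,t)=\frac{1}{\pi\Gamma(\alpha+1)}x^{2\alpha+1}t^{2\alpha}\,dx\,dt$ on $\mathbb{K}$. $L^p_\alpha(\mathbb{K})$ denotes $L^p(\mathbb{K},m_\alpha)$ with norm $\|\cdot\|_{\alpha,p}$. The measure $\gamma_\alpha$ on $\widehat{\mathbb{K}}$ is given by $$\int_{\widehat{\mathbb{K}}} g\,d\gamma_\alpha=\frac{1}{2^{2\alpha-1}\Gamma(\alpha+\frac12)}\sum_{m=0}^\infty L_m^\alpha(0)\int_0^{+\infty} g(\lambda,m)\,\lambda^{3\alpha+1}\,d\lambda ,$$ and $L^p_{\gamma_\alpha}(\widehat{\mathbb{K}})$ denotes $L^p(\widehat{\mathbb{K}},\gamma_\alpha)$ with norm $\|\cdot\|_{\gamma_\alpha,p}$. Homogeneous norm: $|(x,t)|=(x^4+4t^2)^{1/4}$. Laguerre-Bessel transform: for $(\lambda,m)\in\widehat{\mathbb{K}}$ put $\varphi_{(\lambda,m)}(x,t)=j_{\alpha-\frac12}(\lambda t)\,\mathcal{L}_m^\alpha(\lambda x^2)$, where $j_\nu(z)=\Gamma(\nu+1)\sum_{k\ge0}\frac{(-1)^k}{k!\,\Gamma(\nu+k+1)}(z/2)^{2k}$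 is the normalized Bessel function, $\mathcal{L}_m^\alpha(z)=e^{-z/2}L_m^\alpha(z)/L_m^\alpha(0)$, and $L_m^\alpha$ is the Laguerre polynomial of degree $m$ and order $\alpha$. For $f\in L^1_\alpha(\mathbb{K})$, $$\mathcal{F}_{LB}(f)(\lambda,m)=\int_{\mathbb{K}}f(x,t)\,\varphi_{(\lambda,m)}(x,t)\,dm_\alpha(x,t).$$ On $L^2_\alpha(\mathbb{K})$, $\mathcal{F}_{LB}$ denotes the unique continuous extension from $L^1_\alpha(\mathbb{K})\cap L^2_\alpha(\mathbb{K})$ to an operator $L^2_\alpha(\mathbb{K})\to L^2_{\gamma_\alpha}(\widehat{\mathbb{K}})$. *)

(* Defs.v *)
From HB Require Import structures.
From mathcomp Require Import all_boot all_order all_algebra.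
From mathcomp Require Import all_classical all_reals all_analysis measurable_realfun.
From mathcomp.real_closed Require Import complex.

Set Implicit Arguments.
Unset Strict Implicit.
Unset Printing Implicit Defensive.
Import Order.TTheory GRing.Theory Num.Theory.
Import numFieldNormedType.Exports.

Local Open Scope classical_set_scope.
Local Open Scope ring_scope.
Local Open Scope complex_scope.

Section SpecialFunctions.
Context {R : realType}.
Implicit Types a b z nu alpha : R.

(* For 0 < a and 0 < a, 0 < b respectively, the only arguments used below. *)
Definition Gamma a : R :=
  Rintegral lebesgue_measure `[0, +oo[ (fun u : R => u `^ (a - 1) * expR (- u)).

Definition Beta a b : R :=
  Rintegral lebesgue_measure `[0, 1]
    (fun u : R => u `^ (a - 1) * (1 - u) `^ (b - 1)).

Definition bessel_j nu z : R :=
  Gamma (nu + 1) *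
  limn (series (fun k : nat =>
    (-1) ^+ k / (k`!%:R * Gamma (nu + k%:R + 1)) * (z / 2) ^+ k.*2)).

(* The Laguerre polynomial
   L_m^alpha(z) = sum_(k <= m) (-1)^k binom(m + alpha, m - k) z^k / k!. *)
Definition laguerre alpha (m : nat) : {poly R} :=
  \poly_(k < m.+1)
    ((-1) ^+ k * Gamma (m%:R + alpha + 1) /
     (Gamma (k%:R + alpha + 1) * (m - k)`!%:R * k`!%:R)).

Definition laguerre_fun alpha (m : nat) z : R :=
  expR (- (z / 2)) * (laguerre alpha m).[z] / (laguerre alpha m).[0].

Lemma Gamma_ge0 a : 0 <= Gamma a.
Proof.
by apply: Rintegral_ge0 => u _; rewrite mulr_ge0 ?powR_ge0 ?expR_ge0.
Qed.

Lemma laguerre0_ge0 alpha m : 0 <= (laguerre alpha m).[0].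
Proof.
rewrite horner_coef0 coef_poly /= expr0 mul1r.
by rewrite mulr_ge0 ?invr_ge0 ?mulr_ge0 ?ler0n ?Gamma_ge0.
Qed.

End SpecialFunctions.

Section ComplexLp.
Context d {T : measurableType d} {R : realType}.
Variable mu : {measure set T -> \bar R}.
Implicit Types f : T -> R[i].

Definition cmeasurable_fun f : Prop :=
  measurable_fun setT (fun x => complex.Re (f x)) /\
  measurable_fun setT (fun x => complex.Im (f x)).

Definition cintegral (D : set T) f : R[i] :=
  Complex (Rintegral mu D (fun x => complex.Re (f x)))
          (Rintegral mu D (fun x => complex.Im (f x))).

Definition cLnorm (p : \bar R) f : \bar R :=
  Lnorm mu p (fun x => (ComplexField.Normc.normc (f x))%:E).

Definition in_Lp (p : \bar R) f : Prop :=
  cmeasurable_fun f /\ (cLnorm p f < +oo)%E.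

End ComplexLp.

Section Measures.
Context {R : realType}.
Variable alpha : R.

(* The measures live on R * R and R * nat and vanish outside Kset and Khat. *)
Definition Kset : set (R * R) := [set z | 0 <= z.1 /\ 0 <= z.2].
Definition Khat : set (R * nat) := [set p | 0 <= p.1].

Definition m_density (z : R * R) : R :=
  (pi * Gamma (alpha + 1))^-1 *
  (z.1 `^ (2 * alpha + 1) * z.2 `^ (2 * alpha)).

Definition m_alpha (A : set (R * R)) : \bar R :=
  (\int[lebesgue_measure \x lebesgue_measure]_(z in A `&` Kset)
     (m_density z)%:E)%E.

(* The value on a set A of the functional g |-> \int g d(gamma_alpha), that is,
   at g = the indicator of A. *)
Definition gamma_alpha (A : set (R * nat)) : \bar R :=
  (((2 `^ (2 * alpha - 1) * Gamma (alpha + 2^-1))^-1)%:E *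
   \sum_(m <oo) ((laguerre alpha m).[0])%:E *
     \int[lebesgue_measure]_(l in `[0%R, +oo[ `&` ysection A m)
       (l `^ (3 * alpha + 1))%:E)%E.

Lemma measurable_Kset : measurable Kset.
Proof.
have -> : Kset = `[0, +oo[%classic `*` `[0, +oo[%classic.
  by apply/seteqP; split => -[x t] /=; rewrite !in_itv /= !andbT.
exact: measurableX.
Qed.

Lemma m_density_ge0 z : 0 <= m_density z.
Proof.
by rewrite mulr_ge0 ?mulr_ge0 ?invr_ge0 ?mulr_ge0 ?powR_ge0 ?pi_ge0 ?Gamma_ge0.
Qed.

Lemma measurable_m_density : measurable_fun setT m_density.
Proof.
apply: measurable_funM => //; apply: measurable_funM.
- by apply: (measurableT_comp (measurable_powR _)); exact: measurable_fst.
- by apply: (measurableT_comp (measurable_powR _)); exact: measurable_snd.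
Qed.

Let m_alpha0 : m_alpha set0 = 0%E.
Proof. by rewrite /m_alpha set0I integral_set0. Qed.

Let m_alpha_ge0 A : (0 <= m_alpha A)%E.
Proof. by apply: integral_ge0 => z _; rewrite lee_fin m_density_ge0. Qed.

Let m_alpha_sigma_additive : semi_sigma_additive m_alpha.
Proof.
move=> A mA tA mUA.
suff -> : m_alpha (\bigcup_k A k) = (\sum_(k <oo) m_alpha (A k))%E.
  by apply: is_cvg_ereal_nneg_natsum_cond => n _ _; exact: m_alpha_ge0.
rewrite /m_alpha setI_bigcupl ge0_integral_bigcup //=.
- move=> k; apply: measurableI; [exact (mA k) | exact measurable_Kset].
- by apply/measurable_EFinP/measurable_funTS; exact: measurable_m_density.
- by move=> z _; rewrite lee_fin m_density_ge0.
- exact: trivIset_setIr.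
Qed.

HB.instance Definition _ := isMeasure.Build _ _ _
  m_alpha m_alpha0 m_alpha_ge0 m_alpha_sigma_additive.

Let gamma_fibre (m : nat) (A : set (R * nat)) : \bar R :=
  (\int[lebesgue_measure]_(l in `[0%R, +oo[ `&` ysection A m)
     (l `^ (3 * alpha + 1))%:E)%E.

Let gamma_fibre_ge0 m A : (0 <= gamma_fibre m A)%E.
Proof. by apply: integral_ge0 => z _; rewrite lee_fin powR_ge0. Qed.

Let gamma_fibre_bigcup m (A : (set (R * nat))^nat) :
  (forall k, measurable (A k)) -> trivIset setT A ->
  gamma_fibre m (\bigcup_k A k) = (\sum_(k <oo) gamma_fibre m (A k))%E.
Proof.
move=> mA tA; rewrite /gamma_fibre ysection_bigcup setI_bigcupr.
rewrite ge0_integral_bigcup //=.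
- move=> k; apply: measurableI; first exact: measurable_itv.
  exact (measurable_ysection m (mA k)).
- by apply/measurable_EFinP/measurable_funTS; exact: measurable_powR.
- by move=> z _; rewrite lee_fin powR_ge0.
- by apply: trivIset_setIl; exact: trivIset_ysection.
Qed.

Let gamma_alpha0 : gamma_alpha set0 = 0%E.
Proof.
rewrite /gamma_alpha eseries0 ?mule0// => m _ _.
by rewrite ysection0 setI0 integral_set0 mule0.
Qed.

Let gamma_alpha_ge0 A : (0 <= gamma_alpha A)%E.
Proof.
apply: mule_ge0.
  by rewrite lee_fin invr_ge0 mulr_ge0 ?powR_ge0 ?Gamma_ge0.
apply: nneseries_ge0 => m _ _.
by apply: mule_ge0; [rewrite lee_fin laguerre0_ge0 | exact: gamma_fibre_ge0].
Qed.

Let gamma_alpha_sigma_additive : semi_sigma_additive gamma_alpha.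
Proof.
move=> A mA tA mUA.
suff -> : gamma_alpha (\bigcup_k A k) = (\sum_(k <oo) gamma_alpha (A k))%E.
  by apply: is_cvg_ereal_nneg_natsum_cond => n _ _; exact: gamma_alpha_ge0.
have t0 m k : (0 <= ((laguerre alpha m).[0])%:E * gamma_fibre m (A k))%E.
  by apply: mule_ge0; [rewrite lee_fin laguerre0_ge0 | exact: gamma_fibre_ge0].
rewrite /gamma_alpha nneseriesZl; last first.
  by move=> k _; apply: nneseries_ge0 => m _ _; exact: t0.
congr (_ * _)%E; rewrite nneseries_interchange; last by move=> k m; exact: t0.
apply: eq_eseriesr => m _; rewrite nneseriesZl; last first.
  by move=> k _; exact: gamma_fibre_ge0.
by rewrite -/(gamma_fibre _ _) gamma_fibre_bigcup.
Qed.

HB.instance Definition _ := isMeasure.Build _ _ _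
  gamma_alpha gamma_alpha0 gamma_alpha_ge0 gamma_alpha_sigma_additive.

End Measures.

Section LaguerreBessel.
Context {R : realType}.
Variable alpha : R.

Definition hnorm (z : R * R) : R := (z.1 ^+ 4 + 4 * z.2 ^+ 2) `^ (1 / 4).

Definition LB_kernel (p : R * nat) (z : R * R) : R :=
  bessel_j (alpha - 2^-1) (p.1 * z.2) * laguerre_fun alpha p.2 (p.1 * z.1 ^+ 2).

(* The integral formula, meaningful for f in L^1(m_alpha). *)
Definition LB1 (f : R * R -> R[i]) (p : R * nat) : R[i] :=
  cintegral (m_alpha alpha) Kset (fun z => f z * (LB_kernel p z)%:C).

(* Operators between L^2 spaces are represented on functions, with values
   relevant only up to gamma_alpha-null sets; the continuity clause entails
   that T respects equality m_alpha-almost everywhere. *)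
Definition continuous_L2_extension
    (T : (R * R -> R[i]) -> (R * nat -> R[i])) : Prop :=
  [/\ forall f, in_Lp (m_alpha alpha) 2%:E f ->
        in_Lp (gamma_alpha alpha) 2%:E (T f),
      forall f, in_Lp (m_alpha alpha) 1%:E f -> in_Lp (m_alpha alpha) 2%:E f ->
        {ae gamma_alpha alpha, forall p, T f p = LB1 f p}
    & forall f, in_Lp (m_alpha alpha) 2%:E f ->
        forall e : R, 0 < e -> exists2 del : R, 0 < del &
          forall g, in_Lp (m_alpha alpha) 2%:E g ->
            (cLnorm (m_alpha alpha) 2%:E (fun z => (g z - f z)%R) < del%:E)%E ->
            (cLnorm (gamma_alpha alpha) 2%:E
               (fun p => (T g p - T f p)%R) < e%:E)%E].

(* By density of the intersection of L^1 and L^2 and the Plancherel theorem such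
   an extension exists and is unique up to equality almost everywhere; xget
   chooses a representative. *)
Definition LB2 : (R * R -> R[i]) -> (R * nat -> R[i]) :=
  xget (fun _ _ => 0) [set T | continuous_L2_extension T].

Definition M_const (s : R) : R :=
  (Beta ((alpha + 1) / 2) ((2 * alpha + 1) / 2) *
   Beta ((s - 3 * alpha - 2) / s) ((3 * alpha + 2) / s) /
   (4 `^ (alpha + 1) * pi * Gamma (alpha + 1) * (s - 3 * alpha - 2)) *
   ((s - 3 * alpha - 2) / (3 * alpha + 2)) `^ ((3 * alpha + 2) / s)) `^ (1 / 2).

End LaguerreBessel.

(* Main.v *)
(** The kernel satisfies [|phi| <= 1]: the Bessel factor by monotonicity of the energy
    [y^2 + w y'^2] in the variable [w = (z/2)^2], and the Laguerre factor because
    [L^alpha_n] is a nonnegative combination of the [L^0_k], for which [L_k(x)^2 <= e^x] is a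
    single term of the norm identity [sum_m x^m/m! C_k(m; x)^2 = e^x k! x^-k] of the
    Charlier polynomials.  Hence [|F f| <= ||f||_1] pointwise, and the left-hand side is at
    most [gamma(E)^(1/2) ||f||_1].

    Carlson's trick bounds [||f||_1]: Cauchy-Schwarz against the weight [1 + tau |z|^(2s)],
    optimised over [tau], where the integral of the inverse weight is computed by the
    substitution [t = x^2 y / 2] as a product of two Beta integrals.  The constant obtained
    this way is [M / sqrt 2], so the inequality is strict.  Plancherel's theorem is not
    needed: if no continuous extension of the transform existed, [LB2] would be [0]. *)

Require Import Defs.
From mathcomp Require Import all_boot all_order all_algebra.
From mathcomp Require Import all_classical all_reals all_analysis measurable_realfun.
From mathcomp.real_closed Require Import complex.
From mathcomp Require Import ring lra.
Set Implicit Arguments.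
Unset Strict Implicit.
Unset Printing Implicit Defensive.
Import Order.TTheory GRing.Theory Num.Theory.
Import numFieldNormedType.Exports.
Local Open Scope classical_set_scope.
Local Open Scope ring_scope.
Local Open Scope complex_scope.

(** The real-valued integral returns 0 when the integral diverges, so the identities for [Gamma] and
    [Beta] are first proved between extended reals, and finiteness is settled before passing to real
    values. Likewise f is only known to be in L^2, while [LB2] is tied to the integral formula only
    on the intersection of L^1 and L^2: integrability of f has to come out of the weighted
    inequality, which gives it when the weighted norm is finite. When that norm is infinite,
    strictness amounts to finiteness of the left-hand side.

    In the kernel bound, alpha >= 0 acts twice: the Bessel order alpha - 1/2 is then at least -1/2,
    the range in which the energy decreases, and the coefficients of L^alpha_n in the L^0_k are
    nonnegative. Under (x, t) -> (r x, r^2 t) the measure [m_alpha] scales by r^(6 alpha + 4), which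
    explains both the condition s > 3 alpha + 2 (integrability of the inverse weight) and the
    exponent theta = (3 alpha + 2) / s. *)

Lemma integral_gt0 d (T : measurableType d) (R : realType)
    (mu : {measure set T -> \bar R}) (D : set T) (f : T -> \bar R) :
  measurable D -> (0 < mu D)%E -> measurable_fun D f ->
  (forall x, D x -> (0 < f x)%E) -> (0 < \int[mu]_(x in D) f x)%E.
Proof.
move=> mD D0 mf f0; rewrite lt0e integral_ge0 ?andbT; last by move=> x /f0/ltW.
apply: contraTneq D0 => I0; rewrite -leNgt.
have : (\int[mu]_(x in D) `|f x| = 0)%E.
  rewrite -[RHS]I0; apply: eq_integral => x; rewrite inE => /f0/ltW.
  exact: gee0_abs.
move=> /(ae_eq_integral_abs mu mD mf) [N [mN N0 DN]].
rewrite -N0; apply: le_measure; rewrite ?inE // => x Dx; apply: DN => /= /(_ Dx) fx0.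
by have := f0 _ Dx; rewrite fx0 ltxx.
Qed.

(** * Integrals over the half-line as limits over compact intervals *)

Section IntegralsOnHalfLine.
Context {R : realType}.
Local Notation mu := (@lebesgue_measure R).
Implicit Types (f g : R -> R) (a b x y : R).

(** Compact intervals away from 0 and infinity, so that integration by parts and substitution apply
    even to integrands singular at 0. Since [n.+1%:R^-1 <= 1 < n.+2%:R], no interval degenerates. *)
Definition exhaustion (n : nat) : set R := `[n.+1%:R^-1, n.+2%:R].

Lemma measurable_exhaustion n : measurable (exhaustion n).
Proof. exact: measurable_itv. Qed.
Hint Resolve measurable_exhaustion : core.

Lemma exhaustion_nondecreasing : nondecreasing_seq exhaustion.
Proof.
move=> m n mn; apply/subsetPset => x; rewrite /exhaustion /= !in_itv /= => /andP[h1 h2].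
apply/andP; split.
  by apply: le_trans h1; rewrite lef_pV2 ?posrE ?ltr0n // ler_nat ltnS.
by apply: (le_trans h2); rewrite ler_nat !ltnS.
Qed.

Lemma bigcup_exhaustion : \bigcup_n exhaustion n = `](0:R), +oo[%classic :> set R.
Proof.
apply/seteqP; split=> x; rewrite /exhaustion /= in_itv /= andbT.
  move=> [n _]; rewrite /= in_itv /= => /andP[h _]; apply: lt_le_trans h.
  by rewrite invr_gt0 ltr0n.
move=> x0; pose n := maxn (Num.truncn x) (Num.truncn x^-1).
exists n => //=; rewrite in_itv /=; apply/andP; split.
  rewrite -[leRHS]invrK lef_pV2 ?posrE ?ltr0n ?invr_gt0 // ltW //.
  apply: lt_le_trans (truncnS_gt _) _.
  by rewrite ler_nat ltnS leq_maxr.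
apply: le_trans (ltW (truncnS_gt _)) _.
by rewrite ler_nat ltnS ltnW // ltnS leq_maxl.
Qed.

Lemma cvg_integral_exhaustion f : measurable_fun `](0:R), +oo[%classic f ->
  (forall x, 0 < x -> 0 <= f x) ->
  (\int[mu]_(x in exhaustion n) (f x)%:E @[n --> \oo]
   --> \int[mu]_(x in `[0%R, +oo[) (f x)%:E)%E.
Proof.
move=> mf f0; rewrite -integral_itv_obnd_cbnd; last exact/measurable_EFinP.
have -> : [set` `]0%R, +oo[] = `](0:R), +oo[%classic by [].
rewrite -bigcup_exhaustion.
have sub n : exhaustion n `<=` `](0:R), +oo[%classic.
  by rewrite -bigcup_exhaustion; exact: bigcup_sup.
apply: ge0_nondecreasing_set_cvg_integral.
- exact: exhaustion_nondecreasing.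
- by move=> i; exact: measurable_itv.
- by move=> i; apply/measurable_EFinP; apply: measurable_funS mf => //; exact: sub.
- by move=> i x /sub; rewrite /= in_itv /= andbT lee_fin => /f0.
Qed.

Lemma derivable_within_itvcc f a b : (forall x, a <= x <= b -> derivable f x 1) ->
  {within `[a, b], continuous f}.
Proof.
by move=> df; apply: derivable_within_continuous => x; rewrite in_itv /=; apply: df.
Qed.

Lemma derivable_LRcontinuous f a b :
  (forall x, a <= x <= b -> derivable f x 1) -> a <= b ->
  derivable_oo_LRcontinuous f a b.
Proof.
move=> df ab.
have cf x : a <= x <= b -> f y @[y --> x] --> f x.
  by move=> /df /derivable1_diffP /differentiable_continuous.
split.
- by move=> x; rewrite in_itv /= => /andP[h1 h2]; apply: df; rewrite !ltW.
- by apply: cvg_at_right_filter; apply: cf; rewrite lexx.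
- by apply: cvg_at_left_filter; apply: cf; rewrite lexx ab.
Qed.

End IntegralsOnHalfLine.

(** * The Gamma integral: functional equation, finiteness, positivity *)

Section GammaFunction.
Context {R : realType}.
Local Notation mu := (@lebesgue_measure R).
Implicit Types (a u : R).

(** Half of the exponential is kept in reserve: after multiplication by [expR (- u)] there remains
    [expR (- (u / 2))], which serves both for the integrability of the Gamma integrand and for the
    decay of the boundary term at infinity. *)
Lemma powR_le_expR a : 0 <= a ->
  exists2 C : R, 0 < C & forall u, 0 <= u -> u `^ a <= C * expR (u / 2).
Proof.
move=> a0; pose n := (Num.truncn a).+1.
exists (n`!%:R * 2 ^+ n * expR (2^-1)) => [|u u0].
  by rewrite !mulr_gt0 ?expR_gt0 ?exprn_gt0 ?ltr0n ?fact_gt0.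
have u1 : 0 <= 1 + u by rewrite addr_ge0.
(* The base 1 + u is at least 1, so the exponent may be raised to the integer n, where one term of
   the exponential series suffices. *)
apply: (@le_trans _ _ ((1 + u) `^ n%:R)).
  apply: (@le_trans _ _ ((1 + u) `^ a)).
    by apply: ge0_ler_powR => //; rewrite lerDr.
  by apply: ler_powR; rewrite ?lerDl //; exact/ltW/truncnS_gt.
rewrite powR_mulrn //.
have -> : (1 + u) ^+ n = 2 ^+ n * ((1 + u) / 2) ^+ n.
  by rewrite -exprMn mulrC divfK.
have h : ((1 + u) / 2) ^+ n <= n`!%:R * expR ((1 + u) / 2).
  have := expR_ge1Dxn (Num.truncn a) (divr_ge0 u1 (ler0n _ 2)).
  rewrite -ler_pdivrMl ?ltr0n ?fact_gt0 // mulrC => h.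
  by apply: le_trans h; rewrite lerDr.
rewrite [leRHS](_ : _ = 2 ^+ n * (n`!%:R * expR ((1 + u) / 2))); last first.
  by rewrite mulrDl expRD mul1r; ring.
by rewrite ler_wpM2l ?exprn_ge0.
Qed.

Let gint a u := u `^ (a - 1) * expR (- u).

Let gint_ge0 a u : 0 <= gint a u.
Proof. by rewrite mulr_ge0 ?powR_ge0 ?expR_ge0. Qed.

Let measurable_gint a (D : set R) : measurable_fun D (gint a).
Proof.
apply/measurable_funTS; apply: measurable_funM; first exact: measurable_powR.
by apply: measurableT_comp => //; exact: measurable_funN.
Qed.

Let eGamma a : \bar R := (\int[mu]_(u in `[0%R, +oo[) (gint a u)%:E)%E.

Let is_derive_expRN u : is_derive u 1 (fun v : R => expR (- v)) (- expR (- u)).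
Proof. by apply: is_derive_eq; rewrite mulrN1. Qed.

Let eGamma_exhaustion a n : 0 < a ->
  (a%:E * \int[mu]_(u in exhaustion n) (gint a u)%:E =
  (n.+2%:R `^ a * expR (- n.+2%:R) - n.+1%:R^-1 `^ a * expR (- n.+1%:R^-1))%:E
  + \int[mu]_(u in exhaustion n) (gint (a + 1) u)%:E)%E.
Proof.
move=> a0.
have ab : n.+1%:R^-1 < n.+2%:R :> R.
  apply: (@le_lt_trans _ _ 1); last by rewrite ltr1n.
  by rewrite invf_le1 ?ltr0n // ler1n.
have pos (x : R) : n.+1%:R^-1 <= x <= n.+2%:R -> 0 < x.
  by move=> /andP[+ _]; apply: lt_le_trans; rewrite invr_gt0 ltr0n.
have dp b (x : R) : n.+1%:R^-1 <= x <= n.+2%:R -> derivable (fun u => u `^ b) x 1.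
  by move=> /pos x0; apply: ex_derive; exact: is_derive1_powR.
have de (x : R) : n.+1%:R^-1 <= x <= n.+2%:R -> derivable (fun u => expR (- u)) x 1.
  by move=> _; apply: ex_derive; exact: is_derive_expRN.
rewrite -ge0_integralZl //=; last 4 first.
- exact: measurable_exhaustion.
- by apply/measurable_EFinP; exact: measurable_gint.
- by move=> x _; rewrite lee_fin gint_ge0.
- by rewrite lee_fin ltW.
have := @integration_by_parts R (fun u => expR (- u)) (fun u => u `^ a)
  (fun u => - expR (- u)) (fun u => a * u `^ (a - 1)) _ _ ab.
move=> H.
under eq_integral do rewrite -EFinM /gint.
under [X in (_ + X)%E]eq_integral => u _ do rewrite /gint addrK.
transitivity (\int[mu]_(x in exhaustion n)
  (expR (- x) * (a * x `^ (a - 1)))%:E)%E.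
  by apply: eq_integral => x _; congr EFin; ring.
rewrite {1}/exhaustion H.
- rewrite EFinB -!(mulrC (expR _)); congr (_ + _)%E.
  rewrite -[RHS]oppeK; congr (- _)%E; rewrite -integral_ge0N; last first.
    by move=> x _; rewrite lee_fin mulr_ge0 ?powR_ge0 ?expR_ge0.
  by apply: eq_integral => x _; rewrite mulNr EFinN mulrC.
- by apply: derivable_within_itvcc => x /de dx; exact: derivableN.
- by apply: derivable_LRcontinuous => //; exact: ltW.
- by move=> x _; rewrite derive1E; apply: derive_val.
- apply: derivable_within_itvcc => x /pos x0; apply: derivableM => //.
  by apply: ex_derive; exact: is_derive1_powR.
- by apply: derivable_LRcontinuous; [exact: dp | exact: ltW].
- move=> x; rewrite in_itv /= => /andP[x0 _]; rewrite powR_derive1 // in_itv /= andbT.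
  by apply: lt_trans x0; rewrite invr_gt0 ltr0n.
Qed.

Let boundary_cvg0 a : 0 < a ->
  (n.+2%:R : R) `^ a * expR (- n.+2%:R)
   - (n.+1%:R : R)^-1 `^ a * expR (- n.+1%:R^-1) @[n --> \oo] --> (0 : R).
Proof.
move=> a0; rewrite -[X in _ --> X]subr0; apply: cvgB.
  have [C C0 HC] := powR_le_expR (ltW a0).
  apply: (@squeeze_cvgr _ _ _ _ (cst 0) (fun n => C * expR (- (n.+2%:R / 2)))).
  - near=> n; rewrite mulr_ge0 ?powR_ge0 ?expR_ge0 //=.
    have -> : - (n.+2%:R / 2) = n.+2%:R / 2 - n.+2%:R :> R by field.
    by rewrite expRD mulrA ler_wpM2r ?expR_ge0 // HC.
  - exact: cvg_cst.
  - rewrite -[X in _ --> X](mulr0 C); apply: cvgMr.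
    apply: (@cvg_comp _ _ _ (fun n => n.+2%:R / 2) (fun x : R => expR (- x)) _ +oo).
      apply/cvgryPge => A; near=> n.
      rewrite ler_pdivlMr // (@le_trans _ _ n%:R) // ?ler_nat 1?ltnW //.
      by near: n; exact: nbhs_infty_ger.
    exact: cvgr_expR.
apply: (@squeeze_cvgr _ _ _ _ (cst 0) (fun n => n.+1%:R^-1 `^ a)).
- near=> n; rewrite mulr_ge0 ?powR_ge0 ?expR_ge0 //=.
  by apply: ler_piMr; rewrite ?powR_ge0 // expR_le1 oppr_le0 invr_ge0.
- exact: cvg_cst.
- apply: ((cvg_at_rightP _ _ _).1 (powR_cvg0 a0)); split; last exact: cvg_harmonic.
  by move=> n; rewrite invr_gt0 ltr0n.
Unshelve. all: by end_near. Qed.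

(** Passage to the limit in the integration by parts. The equation holds before either side is known
    to be finite; finiteness for 0 < a < 1 is then pulled back from [a + 1], where the integrand has
    no singularity at 0. *)
Let eGammaD1 a : 0 < a -> (a%:E * eGamma a = eGamma (a + 1))%E.
Proof.
move=> a0.
have cva b := @cvg_integral_exhaustion R (gint b) (@measurable_gint b _) (fun x _ => gint_ge0 b x).
have h1 : (a%:E * \int[mu]_(u in exhaustion n) (gint a u)%:E @[n --> \oo] --> a%:E * eGamma a)%E.
  by apply: cvgeZl => //; exact: cva.
rewrite (funext (fun n => eGamma_exhaustion n a0)) in h1.
apply: (cvg_unique _ h1) => //.
rewrite /= -[eGamma (a + 1)]add0e; apply: cvgeD => //.
by apply: cvg_EFin; [exact: nearW | exact: boundary_cvg0].
Qed.

Let integral_expR_half : (\int[mu]_(u in `[0%R, +oo[) (expR (- (u / 2)))%:E = 2%:E :> \bar R)%E.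
Proof.
have ch : continuous (fun u : R => expR (- (u / 2))).
  move=> x; apply: continuous_comp; last exact: continuous_expR.
  by apply: continuousN; exact: cvgMl.
rewrite (@ge0_continuous_FTC2y R _ (fun u => - 2 * expR (- (u / 2))) _ 0).
- by rewrite /= mul0r oppr0 expR0 mulr1 -EFinB; congr EFin; lra.
- by move=> x _; exact: expR_ge0.
- exact: continuous_subspaceT.
- rewrite -[X in _ --> X](mulr0 (- 2)); apply: cvgMr.
  apply: (@cvg_comp _ _ _ (fun u : R => u / 2) (fun x : R => expR (- x)) _ +oo).
    by apply: gt0_cvgMly => //; rewrite invr_gt0.
  exact: cvgr_expR.
- by move=> x _; apply: ex_derive.
- by apply: cvg_at_right_filter; apply: cvgMr; exact: ch.
- by move=> x _; rewrite derive1E derive_val; rewrite /GRing.scale /=; lra.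
Qed.

Let eGamma_lty a : 1 <= a -> (eGamma a < +oo)%E.
Proof.
move=> a1; have [C C0 HC] := @powR_le_expR (a - 1) ltac:(by rewrite subr_ge0).
apply: (@le_lt_trans _ _ (C%:E * \int[mu]_(u in `[0%R, +oo[) (expR (- (u / 2)))%:E)%E).
  rewrite -ge0_integralZl //=; last 2 first.
  - by apply/measurable_EFinP/measurableT_comp => //; exact/measurable_funN/measurable_funM.
  - by rewrite lee_fin ltW.
  apply: ge0_le_integral => //=.
  - by move=> x _; rewrite lee_fin.
  - by apply/measurable_EFinP; exact: measurable_gint.
  - apply: measurable_funeM; apply/measurable_EFinP/measurableT_comp => //.
    exact/measurable_funN/measurable_funM.
  - move=> x; rewrite in_itv /= andbT => x0; rewrite -EFinM lee_fin.
    rewrite [X in _ <= _ * expR X](_ : _ = x / 2 - x); last by field.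
    by rewrite expRD mulrA ler_wpM2r ?expR_ge0 // HC.
by rewrite integral_expR_half -EFinM ltry.
Qed.

Lemma Gamma_integral_fin_num a : 0 < a -> eGamma a \is a fin_num.
Proof.
move=> a0; rewrite ge0_fin_numE; last by apply: integral_ge0 => x _; rewrite lee_fin.
have : (eGamma (a + 1) < +oo)%E by apply: eGamma_lty; rewrite lerDr ltW.
rewrite -eGammaD1 //; case: (eGamma a) => [r||] //; first by move=> _; rewrite ltry.
by rewrite gt0_muley ?lte_fin.
Qed.

Lemma GammaD1 a : 0 < a -> Gamma (a + 1) = a * Gamma a.
Proof.
move=> a0; rewrite /Gamma /Rintegral -!/(gint _ _) -!/(eGamma _) -eGammaD1 //.
by rewrite fineM //; exact: Gamma_integral_fin_num.
Qed.

Lemma Gamma_gt0 a : 0 < a -> 0 < Gamma a.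
Proof.
move=> a0; rewrite lt_neqAle Gamma_ge0 andbT eq_sym; apply/eqP => G0.
have E0 : eGamma a = 0%E.
  by rewrite -[LHS]fineK ?Gamma_integral_fin_num //; congr EFin.
suff : (0 < eGamma a)%E by rewrite E0 ltxx.
rewrite /eGamma -integral_itv_obnd_cbnd; last first.
  by apply/measurable_EFinP; exact: measurable_gint.
apply: integral_gt0 => //.
- by rewrite [ltRHS]lebesgue_measure_itv /= ltry sube0 ltry.
- by apply/measurable_EFinP; exact: measurable_gint.
- by move=> x /=; rewrite in_itv /= andbT => x0; rewrite lte_fin mulr_gt0 ?powR_gt0 ?expR_gt0.
Qed.

End GammaFunction.

(** * The normalized Bessel function is bounded by 1 *)

Section BesselBound.
Local Opaque Gamma.
Context {R : realType}.
Implicit Types (c : R^nat) (C w x z nu : R).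

Lemma is_cvg_pseries_fact c C x : (forall k, `|c k| <= C / k`!%:R) ->
  cvgn (pseries c x).
Proof.
move=> cC; apply: normed_cvg.
have C0 : 0 <= C by have := le_trans (normr_ge0 _) (cC 0%N); rewrite fact0 divr1.
apply: (@series_le_cvg _ _ (fun k => C * exp_coeff `|x| k)).
- by move=> n /=.
- by move=> n; rewrite mulr_ge0 ?exp_coeff_ge0.
- move=> n /=; rewrite normrM normrX /exp_coeff /= [X in C * X]mulrC mulrA.
  by rewrite ler_wpM2r ?exprn_ge0.
- by apply: is_cvg_seriesZ; exact: is_cvg_series_exp_coeff.
Qed.

(** Domination of the coefficients by C / k! survives differentiation with the same C, so termwise
    differentiation can be iterated without tracking radii of convergence. *)
Lemma pseries_diffs_fact c C : (forall k, `|c k| <= C / k`!%:R) ->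
  forall k, `|pseries_diffs c k| <= C / k`!%:R.
Proof.
move=> cC k; rewrite /pseries_diffs normrM normr_nat.
apply: (le_trans (ler_wpM2l (ler0n _ _) (cC _))).
by rewrite factS natrM invfM mulrCA mulVKf // pnatr_eq0.
Qed.

Lemma is_derive_pseries_fact c C x : (forall k, `|c k| <= C / k`!%:R) ->
  is_derive x (1 : R) (fun x => limn (pseries c x)) (limn (pseries (pseries_diffs c) x)).
Proof.
move=> cC; apply: (@pseries_snd_diffs _ _ (`|x| + 1)).
- exact: is_cvg_pseries_fact cC.
- exact: is_cvg_pseries_fact (pseries_diffs_fact cC).
- exact: is_cvg_pseries_fact (pseries_diffs_fact (pseries_diffs_fact cC)).
by rewrite [ltRHS]ger0_norm ?addr_ge0 // ltrDl.
Qed.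

Definition bessel_coef nu (k : nat) : R := (-1) ^+ k / (k`!%:R * Gamma (nu + k%:R + 1)).

(** In the variable w = (z/2)^2 the Bessel equation reads w y'' + (nu + 1) y' + y = 0, and this is
    its power series solution, entire in w. *)
Definition bessel_entire nu w : R := limn (pseries (bessel_coef nu) w).

Lemma bessel_jE nu z : bessel_j nu z = Gamma (nu + 1) * bessel_entire nu ((z / 2) ^+ 2).
Proof.
rewrite /bessel_j /bessel_entire /pseries; congr (_ * _).
by congr (limn (series _)); apply/funext => k /=; rewrite -exprM mul2n.
Qed.

Lemma Gamma_nuS nu (k : nat) : - 2^-1 <= nu ->
  Gamma (nu + k.+1%:R + 1) = (nu + k%:R + 1) * Gamma (nu + k%:R + 1).
Proof.
move=> nu0; rewrite -natr1 addrA GammaD1 //.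
by have := ler0n R k; lra.
Qed.

Lemma bessel_coef_bound nu : - 2^-1 <= nu ->
  exists C, forall k, `|bessel_coef nu k| <= C / k`!%:R.
Proof.
(* Two values are needed: the factor nu + 1 that links them may be as small as 1/2, whereas every
   later factor of the functional equation is at least 3/2. *)
move=> nu0; pose m := Num.min (Gamma (nu + 1)) (Gamma (nu + 1 + 1)).
have m0 : 0 < m by rewrite lt_min !Gamma_gt0 //; lra.
have mG k : m <= Gamma (nu + k%:R + 1).
  elim: k => [|k IH]; first by rewrite addr0 ge_min lexx.
  case: k IH => [_|k IH]; first by rewrite ge_min lexx orbT.
  rewrite (Gamma_nuS _ nu0); apply: (le_trans IH); apply: ler_peMl; first exact: Gamma_ge0.
  by have := ler0n R k; rewrite -natr1; lra.
exists m^-1 => k; rewrite /bessel_coef normrM normrX normrN1 expr1n mul1r normfV.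
rewrite ger0_norm ?mulr_ge0 ?Gamma_ge0 // invfM mulrC ler_wpM2r ?invr_ge0 //.
by rewrite lef_pV2 ?posrE // (lt_le_trans m0).
Qed.

Lemma bessel_coefS nu k : - 2^-1 <= nu ->
  k.+1%:R * (nu + k%:R + 1) * bessel_coef nu k.+1 = - bessel_coef nu k.
Proof.
move=> nu0; rewrite /bessel_coef (Gamma_nuS _ nu0) factS natrM exprS mulN1r !mulNr mulrN.
congr (- _).
have h : nu + k%:R + 1 != 0 by have := ler0n R k; apply: contraTneq => ?; rewrite -ltNge; lra.
have G0 : Gamma (nu + k%:R + 1) != 0.
  by rewrite gt_eqF // Gamma_gt0 //; have := ler0n R k; lra.
field.
rewrite G0 h !pnatr_eq0 /=; apply/andP; split => //.
by rewrite -lt0n fact_gt0.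
Qed.

Section Energy.
Variables (nu : R) (nu_ge : - 2^-1 <= nu).
Local Notation b := (bessel_coef nu).
Local Notation y := (bessel_entire nu).
Local Notation y' w := (limn (pseries (pseries_diffs b) w)).
Local Notation y'' w := (limn (pseries (pseries_diffs (pseries_diffs b)) w)).

Let bessel_entire_ode w : w * y'' w + (nu + 1) * y' w + y w = 0.
Proof.
have [C bC] := bessel_coef_bound nu_ge.
have c0 := @is_cvg_pseries_fact _ _ w bC.
have c1 := @is_cvg_pseries_fact _ _ w (pseries_diffs_fact bC).
have c2 := @is_cvg_pseries_fact _ _ w (pseries_diffs_fact (pseries_diffs_fact bC)).
(* The sums are offset by one so that they cancel exactly for every n: multiplication by w shifts
   the first n terms of y'' to the indices 1, ..., n of the other two sums. *)
have : w * pseries (pseries_diffs (pseries_diffs b)) w n +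
    (nu + 1) * pseries (pseries_diffs b) w n.+1 + pseries b w n.+1 @[n --> \oo]
    --> w * y'' w + (nu + 1) * y' w + y w.
  apply: cvgD; last by rewrite (cvg_shiftS (pseries b w)).
  apply: cvgD; apply: cvgMr => //.
  by rewrite (cvg_shiftS (pseries (pseries_diffs b) w)).
set u := (X in X @ _ --> _).
have -> : u = cst 0.
  apply/funext => n; rewrite /u /pseries /series /=.
  have -> : w * (\sum_(0 <= i < n) pseries_diffs (pseries_diffs b) i * w ^+ i) =
     \sum_(0 <= i < n.+1) i%:R * pseries_diffs b i * w ^+ i.
    rewrite big_nat_recl //= !mul0r add0r big_distrr /=; apply: eq_bigr => i _.
    by rewrite {1}/pseries_diffs exprS; ring.
  rewrite big_distrr -!big_split /= big1 // => i _.
  have /eqP := bessel_coefS i nu_ge; rewrite -addr_eq0 => /eqP h.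
  rewrite /pseries_diffs -[RHS](mul0r (w ^+ i)) -h; ring.
by move=> /cvg_lim <- //; rewrite lim_cst.
Qed.

Let is_derive_y w : is_derive w (1 : R) y (y' w).
Proof. by have [C bC] := bessel_coef_bound nu_ge; exact: is_derive_pseries_fact bC. Qed.

Let is_derive_y' w : is_derive w (1 : R) (fun w => y' w) (y'' w).
Proof.
have [C bC] := bessel_coef_bound nu_ge.
exact: is_derive_pseries_fact (pseries_diffs_fact bC).
Qed.

Let energy w := y w ^+ 2 + w * (y' w) ^+ 2.

(** Replacing w y'' by means of the equation cancels the terms in y y'; what is left has a constant
    sign because nu >= -1/2. *)
Let is_derive_energy w : is_derive w (1 : R) energy (- (2 * nu + 1) * (y' w) ^+ 2).
Proof.
have dy := is_derive_y w; have dy' := is_derive_y' w.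
have d1 := is_deriveX 2 dy; have d2 := is_deriveX 2 dy'.
have d3 := is_deriveM (@is_derive_id _ _ w 1) d2; have d4 := is_deriveD d1 d3.
apply: (@is_derive_eq _ _ _ _ _ _ _ _ d4).
rewrite /GRing.scale /= exprfctE.
have /eqP := bessel_entire_ode w; rewrite addr_eq0 => /eqP h.
have h2 : w * y'' w = - y w - (nu + 1) * y' w by rewrite -h; ring.
transitivity (2 * y w * y' w + (y' w) ^+ 2 + 2 * y' w * (w * y'' w)); first ring.
by rewrite h2; ring.
Qed.

(** For w >= 0 the energy dominates y(w)^2, and at w = 0 it reduces to y(0)^2, the square of the
    constant coefficient. *)
Lemma bessel_entire_le w : 0 <= w -> `|y w| <= (Gamma (nu + 1))^-1.
Proof.
move=> w0; have nu1 : 0 <= 2 * nu + 1 by move: nu_ge; lra.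
have y0 : y 0 = (Gamma (nu + 1))^-1.
  apply/cvg_lim => //; rewrite -cvg_shiftS.
  rewrite (_ : (fun _ => _) = cst (Gamma (nu + 1))^-1); first exact: cvg_cst.
  apply/funext => n; rewrite /pseries /series /= big_nat_recl //= big1.
    by rewrite addr0 mulr1 /bessel_coef expr0 fact0 !mul1r addr0.
  by move=> i _; rewrite exprS mul0r mulr0.
have dE x : derivable energy x 1 by apply: ex_derive; exact: is_derive_energy.
have : energy w <= energy 0.
  apply: (@ler0_derive1_le R energy 0 w _ _ true false) => //.
  - move=> x _; rewrite derive1E (@derive_val _ _ _ _ _ _ _ (is_derive_energy x)).
    by rewrite mulNr oppr_le0 mulr_ge0 ?sqr_ge0.
  - by apply: derivable_within_itvcc => x _; exact: dE.
  - by rewrite in_itv /= lexx w0.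
  - by rewrite in_itv /= w0 lexx.
rewrite /energy mul0r addr0 y0 => h.
have G0 : 0 <= (Gamma (nu + 1))^-1 by rewrite invr_ge0 Gamma_ge0.
rewrite -[leRHS]ger0_norm // -ler_sqr ?nnegrE // !real_normK ?num_real //.
by apply: le_trans h; rewrite lerDl mulr_ge0 ?sqr_ge0.
Qed.

Lemma continuous_bessel_entire : continuous y.
Proof.
by move=> x; apply: differentiable_continuous; apply/derivable1_diffP/ex_derive.
Qed.

End Energy.

Lemma bessel_j_le1 nu z : - 2^-1 <= nu -> `|bessel_j nu z| <= 1.
Proof.
move=> nu0; have G0 : 0 < Gamma (nu + 1) by apply: Gamma_gt0; lra.
rewrite bessel_jE normrM gtr0_norm //.
apply: (@le_trans _ _ (Gamma (nu + 1) * (Gamma (nu + 1))^-1)).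
  by rewrite ler_pM2l // bessel_entire_le // sqr_ge0.
by rewrite mulfV // gt_eqF.
Qed.

Lemma continuous_bessel_j nu : - 2^-1 <= nu -> continuous (bessel_j nu).
Proof.
move=> nu0; rewrite (funext (bessel_jE nu)).
move=> z; apply: cvgMr.
apply: (@continuous_comp _ _ _ (fun z : R => (z / 2) ^+ 2) (bessel_entire nu)).
  apply: differentiable_continuous; apply/derivable1_diffP.
  by have : derivable (fun z : R => (z / 2) ^+ 2) z 1 by [].
exact: continuous_bessel_entire.
Qed.

End BesselBound.

(** * Charlier polynomials and the bound for Laguerre polynomials of order 0 *)

Section LaguerreBound.
Local Opaque Gamma.
Context {R : realType}.
Implicit Types (a b x alpha : R) (m n k N : nat).

(* [charlier a n m] is [a ^+ n] times the Charlier polynomial [C_n(m; a)]. *)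
Fixpoint charlier a n m : R :=
  if n is n'.+1 then a * charlier a n' m - m%:R * charlier a n' m.-1 else 1.

Lemma charlierS a n m :
  charlier a n.+1 m = a * charlier a n m - m%:R * charlier a n m.-1.
Proof. by []. Qed.

(** The forward difference in m lowers the degree, while the defining recurrence raises it; this
    pair drives the summation by parts. The truncated [m.-1] at m = 0 is harmless because its factor
    [m%:R] vanishes. *)
Lemma charlier_diff a n m :
  charlier a n.+1 m.+1 = charlier a n.+1 m - n.+1%:R * charlier a n m.
Proof.
elim: n m => [|n IH] m; first by rewrite /= -natr1; ring.
rewrite (charlierS a n.+1 m.+1) [m.+1.-1]/= IH (charlierS a n.+1 m).
case: m => [|m]; first by rewrite (charlierS a n 0) -!natr1; ring.
rewrite [m.+1.-1]/=; have h1 := IH m; have h2 := charlierS a n m.+1.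
rewrite [m.+1.-1]/= in h2.
have -> : charlier a n.+1 m = charlier a n.+1 m.+1 + n.+1%:R * charlier a n m.
  by rewrite h1; ring.
by rewrite h2 -!natr1; ring.
Qed.

Lemma charlierE a n m :
  charlier a n m = \sum_(k < n.+1) (-1) ^+ k * ('C(n, k) * m ^_ k)%:R * a ^+ (n - k).
Proof.
elim: n m => [|n IH] m.
  by rewrite big_ord1 /= expr0 bin0 ffactn0 mulr1 mul1r.
rewrite charlierS !IH [RHS]big_ord_recl /= expr0 bin0 ffactn0 subn0 mul1r.
under [in RHS]eq_bigr => k _ do
  rewrite binS mulnDl natrD mulrDr mulrDl subSS exprS.
rewrite big_split /= addrA !mulr_sumr; congr (_ + _).
  rewrite big_ord_recl /= expr0 bin0 ffactn0 subn0 muln1 exprS; congr (_ + _).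
    by ring.
  rewrite [RHS]big_ord_recr /= bin_small // mul0n mulr0 mul0r addr0.
  apply: eq_bigr => k _ /=; rewrite exprS /bump /= add1n subnS.
  have -> : (n - k = (n - k).-1.+1)%N by rewrite prednK // subn_gt0.
  by rewrite exprS /=; ring.
rewrite -sumrN; apply: eq_bigr => k _.
by rewrite /bump /= add1n ffactnS !natrM; ring.
Qed.

Lemma normr_charlier_le a n m : 0 <= a -> `|charlier a n m| <= (a + m%:R) ^+ n.
Proof.
move=> a0; elim: n m => [|n IH] m; first by rewrite normr1.
rewrite charlierS exprS mulrDl; apply: le_trans (ler_normB _ _) _.
rewrite !normrM ger0_norm // normr_nat lerD // ler_wpM2l //.
apply: le_trans (IH _) _; rewrite lerXn2r ?nnegrE ?addr_ge0 //.
by rewrite lerD2l ler_nat leq_pred.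
Qed.

(** Truncated squared norm for the weights a^m / m!, a Poisson law up to the factor e^a. Truncation
    keeps the boundary term of the summation by parts explicit. *)
Definition charlier_norm a n N : R :=
  \sum_(m < N) exp_coeff a m * charlier a n m ^+ 2.

Let charlier_norm_recr a n N : charlier_norm a n N.+1 =
  charlier_norm a n N + exp_coeff a N * charlier a n N ^+ 2.
Proof. by rewrite /charlier_norm big_ord_recr. Qed.

(* Summation by parts: multiplication by the raising operator is adjoint to the
   difference operator, up to the boundary term. *)
Lemma charlier_normS a n N :
  charlier_norm a n.+1 N.+1 = a * n.+1%:R * charlier_norm a n N +
    a * exp_coeff a N * charlier a n.+1 N * charlier a n N.
Proof.
elim: N => [|N IH].
  rewrite /charlier_norm big_ord1 big_ord0 mulr0 add0r expr2.
  by rewrite {2}charlierS mul0r subr0; ring.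
rewrite charlier_norm_recr IH (charlier_norm_recr a n N).
have wS : N.+1%:R * exp_coeff a N.+1 = a * exp_coeff a N.
  rewrite /exp_coeff /= factS natrM exprS invfM.
  transitivity (N.+1%:R / N.+1%:R * (a * (a ^+ N / N`!%:R))); first by ring.
  by rewrite mulfV ?mul1r // pnatr_eq0.
have H := charlier_diff a n N.
have H2 : charlier a n.+1 N.+1 = a * charlier a n N.+1 - N.+1%:R * charlier a n N.
  by [].
have -> : exp_coeff a N.+1 * charlier a n.+1 N.+1 ^+ 2 =
    a * exp_coeff a N.+1 * charlier a n.+1 N.+1 * charlier a n N.+1
    - (N.+1%:R * exp_coeff a N.+1) * charlier a n.+1 N.+1 * charlier a n N.
  by rewrite expr2 {2}H2; ring.
by rewrite wS {2}H; ring.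
Qed.

Lemma cvg_exp_coeffM_exp a k : 0 <= a ->
  exp_coeff a N * (a + N%:R) ^+ k.+1 @[N --> \oo] --> (0 : R).
Proof.
move=> a0.
have bnd N : (a + N%:R) ^+ k.+1 <= k.+1`!%:R * expR (a + N%:R).
  have := @expR_ge1Dxn R (a + N%:R) k ltac:(by rewrite addr_ge0).
  rewrite -ler_pdivrMl ?ltr0n ?fact_gt0 // mulrC.
  by apply: le_trans; rewrite lerDr.
(* The factor e^N coming from [bnd] is absorbed by replacing a with a e in the exponential
   coefficient, which still tends to 0. *)
apply: (@squeeze_cvgr _ _ _ _ (cst 0)
  (fun N => k.+1`!%:R * expR a * exp_coeff (a * expR 1) N)).
- near=> N; rewrite mulr_ge0 ?exp_coeff_ge0 ?exprn_ge0 ?addr_ge0 //=.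
  apply: (le_trans (ler_wpM2l (exp_coeff_ge0 _ a0) (bnd N))).
  rewrite /exp_coeff /= exprMn expRD -expRM_natl mulr1 le_eqVlt; apply/orP; left.
  by apply/eqP; ring.
- exact: cvg_cst.
- rewrite -[X in _ --> X](mulr0 (k.+1`!%:R * expR a)); apply: cvgMr.
  exact: cvg_series_cvg_0 (is_cvg_series_exp_coeff _).
Unshelve. all: by end_near. Qed.

Lemma cvg_charlier_norm a n : 0 <= a ->
  charlier_norm a n N @[N --> \oo] --> expR a * n`!%:R * a ^+ n.
Proof.
move=> a0; elim: n => [|n IH].
  rewrite fact0 !mulr1 expRE.
  have := is_cvg_series_exp_coeff a.
  rewrite /pseries -exp_coeffE => h.
  rewrite (_ : charlier_norm a 0 = series (exp_coeff a)) //.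
  apply/funext => N; rewrite /charlier_norm /series /= big_mkord.
  by apply: eq_bigr => i _; rewrite expr1n mulr1.
rewrite -cvg_shiftS (funext (charlier_normS a n)).
rewrite -[expR a * _ * _]addr0.
apply: cvgD.
  have -> : expR a * n.+1`!%:R * a ^+ n.+1 = a * n.+1%:R * (expR a * n`!%:R * a ^+ n).
    by rewrite factS natrM exprS; ring.
  exact: cvgMr.
(* The boundary term: the two Charlier factors together grow like a polynomial of degree 2n + 1 in
   N, against the factorial decay of [exp_coeff a N]. *)
apply/norm_cvg0P.
apply: (@squeeze_cvgr _ _ _ _ (cst 0)
   (fun N => a * (exp_coeff a N * (a + N%:R) ^+ (n + n).+1))).
- near=> N; apply/andP; split; first exact: normr_ge0.
  have := exp_coeff_ge0 N a0; move: (exp_coeff a N) => w w0.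
  rewrite -!mulrA normrM (ger0_norm a0) ler_wpM2l //.
  rewrite normrM (ger0_norm w0) ler_wpM2l // normrM -addSn exprD.
  by apply: ler_pM => //; exact: normr_charlier_le.
- exact: cvg_cst.
- by rewrite -[X in _ --> X](mulr0 a); apply: cvgMr; exact: cvg_exp_coeffM_exp.
Unshelve. all: by end_near. Qed.

Definition laguerre0 n x : R := \sum_(k < n.+1) (-1) ^+ k * 'C(n, k)%:R * x ^+ k / k`!%:R.

(** Reversing the sum, k -> n - k, turns the falling factorial into n! / k!, which is what the
    Laguerre coefficients contain. *)
Lemma charlier_diag a n : charlier a n n = (-1) ^+ n * n`!%:R * laguerre0 n a.
Proof.
rewrite charlierE (reindex_inj rev_ord_inj) /laguerre0 mulr_sumr.
apply: eq_bigr => -[k /= kn] _; rewrite subSS.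
have kn' : (k <= n)%N by rewrite -ltnS.
rewrite subKn // bin_sub // natrM.
have -> : (n ^_ (n - k))%:R = n`!%:R / k`!%:R :> R.
  by rewrite -(ffact_fact (leq_subr k n)) subKn // natrM mulfK.
have -> : (-1) ^+ (n - k) = (-1) ^+ n * (-1) ^+ k :> R.
  by rewrite -exprD -[in RHS](subnK kn') -addnA addnn exprD -mul2n exprM sqrrN !expr1n mulr1.
by ring.
Qed.

Lemma laguerre0_le n x : 0 <= x -> `|laguerre0 n x| <= expR (x / 2).
Proof.
move=> x0.
suff h : laguerre0 n x ^+ 2 <= expR x.
  rewrite -ler_sqr ?nnegrE ?expR_ge0 // real_normK ?num_real //.
  by rewrite -expRM_natl mulr_natl -mulr_natr divfK.
(* The estimate below is divided by x^n, so the origin, where the polynomial equals 1, is treated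
   apart. *)
have [->|xn0] := eqVneq x 0.
  rewrite /laguerre0 big_ord_recl /= big1 => [|i _].
    by rewrite !expr0 bin0 fact0 !mulr1 divr1 addr0 expr1n expR0.
  by rewrite expr0n /= mulr0 mul0r.
have h : exp_coeff x n * charlier x n n ^+ 2 <= expR x * n`!%:R * x ^+ n.
  apply: (cvgr_to_ge (@cvg_charlier_norm x n x0)); near=> N.
  have nN : (n < N)%N by near: N; exact: nbhs_infty_gt.
  rewrite /charlier_norm (bigD1 (Ordinal nN)) //= lerDl sumr_ge0 // => i _.
  by rewrite mulr_ge0 ?exp_coeff_ge0 ?sqr_ge0.
have xn : 0 < x ^+ n by rewrite exprn_gt0 // lt_neqAle eq_sym xn0.
have nf : 0 < n`!%:R :> R by rewrite ltr0n fact_gt0.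
rewrite -(ler_pM2r nf) -(ler_pM2r xn); apply: le_trans h.
rewrite charlier_diag /exp_coeff /= !exprMn sqrr_sign mul1r le_eqVlt; apply/orP; left.
by apply/eqP; field; rewrite gt_eqF.
Unshelve. all: by end_near. Qed.

End LaguerreBound.

(** * Laguerre polynomials of order alpha in terms of those of order 0 *)

Section LaguerreConnection.
Local Opaque Gamma.
Context {R : realType}.
Implicit Types (a b x alpha : R) (m n k N : nat).

(* The coefficients of [(1 - X)^(-a)]. *)
Definition neg_bin N a : R := \prod_(i < N) (a + i%:R) / N`!%:R.

Lemma neg_binS N a : N.+1%:R * neg_bin N.+1 a = (a + N%:R) * neg_bin N a.
Proof.
rewrite /neg_bin big_ord_recr /= factS natrM invfM.
transitivity (N.+1%:R / N.+1%:R * ((a + N%:R) * (\prod_(i < N) (a + i%:R) / N`!%:R))).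
  by ring.
by rewrite mulfV ?mul1r // pnatr_eq0.
Qed.

Lemma neg_bin_ge0 N a : 0 <= a -> 0 <= neg_bin N a.
Proof.
by move=> a0; rewrite divr_ge0 // prodr_ge0 // => i _; rewrite addr_ge0.
Qed.

(** This is (1 - X)^(-a) (1 - X)^(-b) = (1 - X)^(-(a + b)) read on coefficients. In the induction N
    + 1 is split as (N + 1 - l) + l and [neg_binS] is applied to each half; the resulting factors (a
    + N - l) and (b + l) add up to a + b + N. *)
Lemma neg_binD N a b :
  \sum_(l < N.+1) neg_bin (N - l) a * neg_bin l b = neg_bin N (a + b).
Proof.
elim: N => [|N IH].
  by rewrite big_ord1 /neg_bin !big_ord0 fact0 divr1 mulr1.
apply: (@mulfI _ N.+1%:R); first by rewrite pnatr_eq0.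
rewrite neg_binS -IH !mulr_sumr.
transitivity (\sum_(l < N.+2) ((N.+1 - l)%N%:R * neg_bin (N.+1 - l) a * neg_bin l b
    + neg_bin (N.+1 - l) a * (l%:R * neg_bin l b))).
  apply: eq_bigr => -[l /= lN] _.
  have {1}-> : N.+1%:R = (N.+1 - l)%:R + l%:R :> R by rewrite -natrD subnK.
  by ring.
rewrite big_split /= [X in X + _]big_ord_recr /= subnn mul0r mul0r addr0.
rewrite [X in _ + X]big_ord_recl /= mul0r mulr0 add0r -big_split /=.
apply: eq_bigr => -[l /= lN] _.
have lN' : (l <= N)%N by rewrite -ltnS.
rewrite subSn // neg_binS /bump /= add1n neg_binS subSS.
have -> : N%:R = (N - l)%:R + l%:R :> R by rewrite -natrD subnK.
by ring.
Qed.

Lemma neg_bin_nat l j : neg_bin l (j.+1%:R : R) = 'C(j + l, l)%:R.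
Proof.
elim: l => [|l IH]; first by rewrite /neg_bin big_ord0 bin0 fact0 divr1.
apply: (@mulfI _ l.+1%:R); first by rewrite pnatr_eq0.
by rewrite neg_binS IH -natrD -!natrM addSnnS -mul_bin_diag addnS.
Qed.

Lemma Gamma_prod N a : 0 < a -> Gamma (a + N%:R) = Gamma a * \prod_(i < N) (a + i%:R).
Proof.
move=> a0; elim: N => [|N IH]; first by rewrite big_ord0 addr0 mulr1.
rewrite -natr1 addrA GammaD1 ?ltr_wpDr // IH big_ord_recr /=; ring.
Qed.

Lemma laguerre_coef alpha n j : 0 <= alpha -> (j <= n)%N ->
  (laguerre alpha n)`_j = (-1) ^+ j / j`!%:R * neg_bin (n - j) (alpha + j.+1%:R).
Proof.
move=> alpha0 jn; rewrite coef_poly ltnS jn.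
have a0 : 0 < alpha + j.+1%:R by rewrite ltr_wpDl.
have -> : n%:R + alpha + 1 = alpha + j.+1%:R + (n - j)%:R.
  have -> : n%:R = (n - j)%:R + j%:R :> R by rewrite -natrD subnK.
  by rewrite -natr1; ring.
have -> : j%:R + alpha + 1 = alpha + j.+1%:R by rewrite -natr1; ring.
rewrite Gamma_prod // /neg_bin !invfM.
have G0 : Gamma (alpha + j.+1%:R) != 0 by rewrite gt_eqF // Gamma_gt0.
move: (Gamma _) G0 => G G0.
transitivity (G / G * ((-1) ^+ j / j`!%:R *
  (\prod_(i < n - j) (alpha + j.+1%:R + i%:R) / (n - j)`!%:R))); first by ring.
by rewrite mulfV ?mul1r.
Qed.

(** On generating functions: (1 - X)^(-alpha - 1) exp(-x X / (1 - X)) is (1 - X)^(-alpha) times the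
    same function at order 0. The proof compares coefficients of x^j. *)
Lemma laguerre_connection alpha n x : 0 <= alpha ->
  (laguerre alpha n).[x] = \sum_(k < n.+1) neg_bin (n - k) alpha * laguerre0 k x.
Proof.
move=> alpha0; rewrite (@horner_coef_wide _ n.+1); last exact: size_poly.
transitivity (\sum_(k < n.+1) \sum_(j < n.+1)
    neg_bin (n - k) alpha * ((-1) ^+ j * 'C(k, j)%:R * x ^+ j / j`!%:R)); last first.
  apply: eq_bigr => -[k /= kn] _; rewrite -mulr_sumr; congr (_ * _).
  rewrite /laguerre0 (big_ord_widen _ (fun j => (-1) ^+ j * 'C(k, j)%:R * x ^+ j / j`!%:R) kn).
  rewrite [RHS]big_mkcond; apply: eq_bigr => j _; case: ifPn => //.
  by rewrite -leqNgt => kj; rewrite bin_small // mulr0 !mul0r.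
rewrite exchange_big; apply: eq_bigr => -[j /= jn] _.
rewrite laguerre_coef //.
transitivity ((-1) ^+ j / j`!%:R * x ^+ j *
  \sum_(k < n.+1) neg_bin (n - k) alpha * 'C(k, j)%:R); last first.
  by rewrite mulr_sumr; apply: eq_bigr => k _; ring.
rewrite -(big_mkord xpredT (fun k => neg_bin (n - k) alpha * 'C(k, j)%:R)).
rewrite (@big_cat_nat _ _ _ j) //=; last exact: ltnW.
rewrite big_nat_cond big1 ?add0r; last first.
  by move=> k; rewrite andbT => /andP[_ kj]; rewrite bin_small ?mulr0.
(* With k = j + l the binomial is [neg_bin l] at j + 1, so the sum is the convolution of [neg_binD]
   with parameters alpha and j + 1. *)
rewrite -[X in \big[_/_]_(X <= _ < _) _]add0n big_addn subSn // big_mkord -neg_binD mulrAC; congr (_ * _).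
apply: eq_bigr => -[l /= _] _; rewrite neg_bin_nat (addnC l) subnDA.
by rewrite -(bin_sub (leq_addr l j)) addKn.
Qed.

(** Each order 0 polynomial equals 1 at the origin, so the normalizing value is the sum of the same
    nonnegative coefficients and the order 0 bound passes through termwise. *)
Lemma laguerre_fun_le1 alpha n x : 0 <= alpha -> 0 <= x -> `|laguerre_fun alpha n x| <= 1.
Proof.
move=> alpha0 x0; rewrite /laguerre_fun.
have L0 : (laguerre alpha n).[0] = \sum_(k < n.+1) neg_bin (n - k) alpha.
  rewrite laguerre_connection //; apply: eq_bigr => k _.
  rewrite /laguerre0 big_ord_recl big1 => [|i _]; last by rewrite expr0n /= mulr0 mul0r.
  by rewrite !expr0 bin0 fact0 !mulr1 divr1 addr0 mulr1.
rewrite normrM normfV (ger0_norm (laguerre0_ge0 _ _)) normrM gtr0_norm ?expR_gt0 //.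
have := laguerre0_ge0 alpha n; rewrite le_eqVlt => /predU1P[<-|Lp].
  by rewrite invr0 mulr0.
rewrite ler_pdivrMr // mul1r expRN ler_pdivrMl ?expR_gt0 // mulrC L0.
rewrite laguerre_connection // mulr_suml; apply: le_trans (ler_norm_sum _ _ _) _.
apply: ler_sum => k _; rewrite normrM ger0_norm ?neg_bin_ge0 // ler_wpM2l ?neg_bin_ge0 //.
exact: laguerre0_le.
Qed.

End LaguerreConnection.

(** * Change of variables and Beta integrals over the half-line *)

Section Substitution.
Context {R : realType}.
Local Notation mu := (@lebesgue_measure R).
Implicit Types (F dF G : R -> R) (D : set R) (a b x y k : R).

Lemma derive1_continuous0y F dF x : (forall x, 0 < x -> is_derive x 1 F (dF x)) ->
  (forall x, 0 < x -> {for x, continuous dF}) -> 0 < x ->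
  (F^`()%classic) y @[y --> x] --> (F^`()%classic) x.
Proof.
move=> Fd cd x0; rewrite [(F^`()%classic) x]derive1E (@derive_val _ _ _ _ _ _ _ (Fd _ x0)).
apply: cvg_trans (cd _ x0); apply: near_eq_cvg; near=> z.
have z0 : 0 < z by near: z; exact: lt_nbhsr.
by rewrite derive1E (@derive_val _ _ _ _ _ _ _ (Fd _ z0)).
Unshelve. all: by end_near. Qed.

(** Substitution on each compact interval, then monotone limits on both sides. [FD] and [DF] make D
    the image of the open half-line, so the images of the intervals fill D; nothing is asked at the
    endpoints, where G and the derivative may blow up. *)
Lemma ge0_integral_decreasing_substitution0y F dF G D :
  (forall x, 0 < x -> is_derive x 1 F (dF x)) ->
  (forall x, 0 < x -> {for x, continuous dF}) ->
  (forall x y, 0 < x -> x < y -> F y < F x) ->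
  (forall x y, 0 < x -> 0 < y -> [set` `[F y, F x]] `<=` D) ->
  (forall u, D u -> exists2 x, 0 < x & F x = u) ->
  measurable D -> measurable_fun D G ->
  {in D, continuous G} -> (forall u, D u -> 0 <= G u) ->
  (forall x, 0 < x -> 0 <= - dF x) ->
  measurable_fun `](0:R), +oo[ (fun x => G (F x) * - dF x) ->
  (\int[mu]_(u in D) (G u)%:E =
   \int[mu]_(x in `[0%R, +oo[) (G (F x) * - dF x)%:E)%E.
Proof.
move=> Fd cd decF FD DF mD mG cG G0 dF0 mH.
have pos n x : exhaustion n x -> 0 < x.
  by rewrite /exhaustion /= in_itv /= => /andP[+ _]; apply: lt_le_trans; rewrite invr_gt0.
have leF x y : 0 < x -> x <= y -> F y <= F x.
  by move=> x0; rewrite le_eqVlt => /predU1P[-> //|/(decF _ _ x0)/ltW].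
pose E n : set R := [set` `[F n.+2%:R, F n.+1%:R^-1]].
have mE n : measurable (E n) by exact: measurable_itv.
have ED n : E n `<=` D by apply: FD; rewrite ?invr_gt0.
have UE : \bigcup_n E n = D.
  apply/seteqP; split=> u; first by move=> [n _] /ED.
  move=> /DF[x x0 <-].
  have : (`](0:R), +oo[%classic : set R) x by rewrite /= in_itv /= x0.
  rewrite -bigcup_exhaustion => -[n _ xn]; exists n => //.
  have := pos _ _ xn; move: xn; rewrite /exhaustion /E /= !in_itv /= => /andP[h1 h2] _.
  by rewrite !leF // ?invr_gt0.
have c1 : (\int[mu]_(u in E n) (G u)%:E @[n --> \oo] --> \int[mu]_(u in D) (G u)%:E)%E.
  rewrite -UE; apply: ge0_nondecreasing_set_cvg_integral => //.
  - move=> m n mn; apply/subsetPset => u; rewrite /E /= !in_itv /= => /andP[h1 h2].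
    apply/andP; split.
      by apply: le_trans h1; apply: leF => //; rewrite ler_nat !ltnS.
    apply: (le_trans h2); apply: leF; rewrite ?invr_gt0 //.
    by rewrite lef_pV2 ?posrE ?ltr0n // ler_nat ltnS.
  - by move=> n; apply/measurable_EFinP; exact: measurable_funS mG.
  - by move=> n u /ED /G0; rewrite lee_fin.
have H0 x : 0 < x -> 0 <= G (F x) * - dF x.
  move=> x0; apply: mulr_ge0; last exact: dF0.
  by apply: G0; apply: (FD x x) => //; rewrite /= in_itv /= !lexx.
have c2 := cvg_integral_exhaustion mH H0.
apply: (cvg_unique _ c1) => //=.
suff -> : (fun n => \int[mu]_(u in E n) (G u)%:E)%E =
          (fun n => \int[mu]_(x in exhaustion n) (G (F x) * - dF x)%:E)%E by [].
apply/funext => n.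
have ab : n.+1%:R^-1 <= n.+2%:R :> R.
  by apply: (@le_trans _ _ 1); rewrite ?ler1n // invf_le1 ?ltr0n // ler1n.
have a0 : 0 < n.+1%:R^-1 :> R by rewrite invr_gt0.
have b0 : 0 < n.+2%:R :> R by [].
rewrite /E integration_by_substitution_decreasing //.
- apply: eq_integral => x; rewrite inE => /pos x0; congr (_ * _)%:E.
  by rewrite opprfctE derive1E (@derive_val _ _ _ _ _ _ _ (Fd _ x0)).
- move=> x y; rewrite !in_itv /= => /andP[ax _] /andP[ay _] yx.
  by apply: decF => //; exact: lt_le_trans ay.
- move=> x; rewrite in_itv /= => /andP[ax _].
  by apply: (derive1_continuous0y Fd cd); exact: lt_trans ax.
- apply/cvg_ex; exists (F^`()%classic n.+1%:R^-1).
  by apply: cvg_at_right_filter; exact: (derive1_continuous0y Fd cd).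
- apply/cvg_ex; exists (F^`()%classic n.+2%:R).
  by apply: cvg_at_left_filter; exact: (derive1_continuous0y Fd cd).
- apply: derivable_LRcontinuous => // x /andP[ax _].
  by apply: ex_derive; apply: Fd; exact: lt_le_trans ax.
- by apply: continuous_in_subspaceT => u; rewrite inE => /ED Du; apply: cG; rewrite inE.
Qed.

End Substitution.

Section BetaIntegral.
Context {R : realType}.
Local Notation mu := (@lebesgue_measure R).
Implicit Types (p q r d x y : R).

Let powR_add_gt0 d q y : 0 < d -> 0 < 1 + d * y `^ q.
Proof. by move=> d0; rewrite ltr_wpDr // mulr_ge0 ?powR_ge0 // ltW. Qed.

Lemma is_derive_inv_powR d q y : 0 < d -> 0 < y ->
  is_derive y (1 : R) (fun y => (1 + d * y `^ q)^-1)
    (- (q * d * y `^ (q - 1) * (1 + d * y `^ q) `^ (- 2))).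
Proof.
move=> d0 y0; have w0 := powR_add_gt0 q y d0.
have h1 := is_derive1_powR q y0.
have h2 : is_derive y (1 : R) (fun y => 1 + d * y `^ q) (d * (q * y `^ (q - 1))).
  have h := is_deriveD (is_derive_cst (1 : R) y (1 : R)) (is_deriveZ d h1).
  by apply: (@is_derive_eq _ _ _ _ _ _ _ _ h); rewrite add0r.
have h3 := @is_deriveV R (fun y => 1 + d * y `^ q) y _ _ (lt0r_neq0 w0) h2.
apply: (@is_derive_eq _ _ _ _ _ _ _ _ h3).
rewrite /GRing.scale /= powR_invn ?(ltW w0) //; ring.
Qed.

Lemma continuous_powR_gt0 q x : 0 < x -> {for x, continuous (fun y => y `^ q)}.
Proof.
move=> x0; apply: differentiable_continuous; apply/derivable1_diffP/ex_derive.
exact: is_derive1_powR.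
Qed.

Lemma measurable_beta_integrand p q r d (D : set R) :
  measurable_fun D (fun y => y `^ (p - 1) * (1 + d * y `^ q) `^ (- r)).
Proof.
apply/measurable_funTS; apply: measurable_funM; first exact: measurable_powR.
apply: (measurableT_comp (measurable_powR _)); apply: measurable_funD => //.
by apply: measurable_funM => //; exact: measurable_powR.
Qed.

(** The substitution is u = 1 / (1 + d y^q), for which 1 - u = d y^q u. As an identity of extended
    reals it also carries finiteness from the half-line over to [0, 1]. *)
Lemma beta_substitution p q r d : 0 < q -> 0 < d ->
  (\int[mu]_(u in `[0%R, 1%R]) (u `^ (r - p / q - 1) * (1 - u) `^ (p / q - 1))%:E =
   (q * d `^ (p / q))%:E *
   \int[mu]_(y in `[0%R, +oo[) (y `^ (p - 1) * (1 + d * y `^ q) `^ (- r))%:E)%E.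
Proof.
move=> q0 d0.
pose F y := (1 + d * y `^ q)^-1.
pose dF y := - (q * d * y `^ (q - 1) * (1 + d * y `^ q) `^ (- 2)).
pose G u := u `^ (r - p / q - 1) * (1 - u) `^ (p / q - 1).
have F01 y : 0 < y -> 0 < F y < 1.
  move=> y0; rewrite invr_gt0 powR_add_gt0 //= invf_lt1 ?powR_add_gt0 // ltrDl.
  by rewrite mulr_gt0 ?powR_gt0.
have E y : 0 < y -> G (F y) * - dF y =
    q * d `^ (p / q) * (y `^ (p - 1) * (1 + d * y `^ q) `^ (- r)).
  move=> y0; have w0 := powR_add_gt0 q y d0.
  have dq0 : 0 < d * y `^ q by rewrite mulr_gt0 ?powR_gt0.
  rewrite /G /dF /F opprK.
  have -> : 1 - (1 + d * y `^ q)^-1 = d * y `^ q * (1 + d * y `^ q)^-1.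
    by field; rewrite gt_eqF.
  move: w0; set w := 1 + d * y `^ q => w0.
  rewrite -powR_inv1 ?(ltW w0) // -powRrM powRM ?(ltW dq0) ?powR_ge0 // -powRrM.
  rewrite powRM ?powR_ge0 ?(ltW d0) // -powRrM.
  have dE : d `^ (p / q) = d `^ (p / q - 1) * d.
    by rewrite -{3}(powRr1 (ltW d0)) -powRD ?subrK // (gt_eqF d0) implybT.
  have yE : y `^ (p - 1) = y `^ (q * (p / q - 1)) * y `^ (q - 1).
    rewrite -powRD ?(gt_eqF y0) ?implybT //; congr (_ `^ _); field; exact: lt0r_neq0.
  have wE : w `^ (- r) = w `^ (-1 * (r - p / q - 1)) * w `^ (-1 * (p / q - 1)) * w `^ (- 2).
    by rewrite -!powRD ?(gt_eqF w0) ?implybT //; congr (_ `^ _); ring.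
  by rewrite dE yE wE; ring.
rewrite -ge0_integralZl //=; last 3 first.
- by apply/measurable_EFinP; exact: measurable_beta_integrand.
- by move=> y _; rewrite lee_fin mulr_ge0 ?powR_ge0.
- by rewrite lee_fin mulr_ge0 ?powR_ge0 // ltW.
have mG (D : set R) : measurable_fun D G.
  apply/measurable_funTS; apply: measurable_funM; first exact: measurable_powR.
  by apply: (measurableT_comp (measurable_powR _)); exact: measurable_funB.
have mw c : measurable_fun setT (fun y => (1 + d * y `^ q) `^ c).
  apply: (measurableT_comp (measurable_powR _)); apply: measurable_funD => //.
  by apply: measurable_funM => //; exact: measurable_powR.
have mF : measurable_fun setT F.
  rewrite (_ : F = fun y => (1 + d * y `^ q) `^ (- 1)) //.
  by apply/funext => y; rewrite powR_inv1 // ltW // powR_add_gt0.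
have mH (D : set R) : measurable_fun D (fun x => G (F x) * - dF x).
  apply/measurable_funTS; apply: measurable_funM; first exact: (measurableT_comp (mG _)).
  apply: measurableT_comp => //; apply: measurableT_comp => //; apply: measurable_funM => //.
  by apply: measurable_funM => //; exact: measurable_powR.
rewrite integral_itv_bndoo; last by apply/measurable_EFinP; exact: mG.
have Fd x : 0 < x -> is_derive x (1 : R) F (dF x) by exact: is_derive_inv_powR.
rewrite (@ge0_integral_decreasing_substitution0y R F dF G _ Fd) //.
- rewrite -!integral_itv_obnd_cbnd; last 2 first.
  + by apply: measurable_funeM; apply/measurable_EFinP; exact: measurable_beta_integrand.
  + by apply/measurable_EFinP; exact: mH.
  by apply: eq_integral => y; rewrite inE /= in_itv /= andbT => /E ->.
- move=> x x0; apply: cvgN; apply: cvgM.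
    by apply: cvgMr; exact: continuous_powR_gt0.
  apply: (@continuous_comp _ _ _ (fun x => 1 + d * x `^ q) (fun w => w `^ (- 2))).
    by apply: cvgD; [exact: cvg_cst | apply: cvgMr; exact: continuous_powR_gt0].
  by apply: continuous_powR_gt0; exact: powR_add_gt0.
- move=> x y x0 xy; rewrite /F ltf_pV2 ?posrE ?powR_add_gt0 // ltrD2l ltr_pM2l //.
  by apply: gt0_ltr_powR => //; rewrite ?nnegrE ?(ltW x0) // ltW // (lt_trans x0).
- move=> x y /F01 /andP[_ x1] /F01 /andP[y0 _] u; rewrite /= !in_itv /= => /andP[h1 h2].
  by rewrite (lt_le_trans y0) // (le_lt_trans h2).
- move=> u; rewrite /= in_itv /= => /andP[u0 u1].
  exists (((u^-1 - 1) / d) `^ q^-1).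
    by rewrite powR_gt0 // divr_gt0 // subr_gt0 invf_gt1.
  rewrite /F -powRrM mulVf ?gt_eqF // powRr1.
    by rewrite mulrC divfK ?gt_eqF // addrC subrK invrK.
  by rewrite divr_ge0 ?(ltW d0) // subr_ge0 ltW // invf_gt1.
- move=> u; rewrite inE /= in_itv /= => /andP[u0 u1].
  suff : {for u, continuous G} by []; apply: cvgM.
    by apply: continuous_powR_gt0.
  apply: (@continuous_comp _ _ _ (fun u : R => 1 - u) (fun w => w `^ (p / q - 1))).
    by apply: cvgB; [exact: cvg_cst | exact: cvg_id].
  by apply: continuous_powR_gt0; rewrite subr_gt0.
- by move=> u _; rewrite mulr_ge0 ?powR_ge0.
- by move=> x x0; rewrite opprK !mulr_ge0 ?powR_ge0 ?(ltW q0) ?(ltW d0).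
Qed.

End BetaIntegral.

Section BetaFinite.
Context {R : realType}.
Local Notation mu := (@lebesgue_measure R).
Implicit Types (p q r d x y c : R).

Lemma cvgr_powRN c : 0 < c -> y `^ (- c) @[y --> +oo] --> (0 : R).
Proof.
move=> c0.
have h : expR (- (c * ln y)) @[y --> +oo] --> (0 : R).
  apply: (@cvg_comp _ _ _ (fun y => c * ln y) (fun x : R => expR (- x)) _ +oo).
    apply/cvgryPge => A; near=> y.
    rewrite mulrC -ler_pdivrMr // -[leLHS]expRK ler_ln ?posrE ?expR_gt0 //.
  exact: cvgr_expR.
apply: cvg_trans h; apply: near_eq_cvg; near=> y.
by rewrite /powR gt_eqF ?mulNr.
Unshelve. all: by end_near. Qed.

Lemma integral_powR_shift c : 0 < c ->
  (\int[mu]_(y in `[0%R, +oo[) ((1 + y) `^ (- c - 1))%:E = (c^-1)%:E)%E.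
Proof.
move=> c0.
have pos y : 0 <= y -> 0 < 1 + y by move=> y0; rewrite ltr_wpDr.
have dF y : 0 <= y -> is_derive y (1 : R) (fun y => - c^-1 * (1 + y) `^ (- c))
    ((1 + y) `^ (- c - 1)).
  move=> /pos y0.
  have h1 : is_derive y (1 : R) (fun y => 1 + y) 1.
    have h := is_deriveD (is_derive_cst (1 : R) y (1 : R)) (is_derive_id y (1 : R)).
    by apply: (@is_derive_eq _ _ _ _ _ _ _ _ h); rewrite add0r.
  have h2 := is_derive1_comp (is_derive1_powR (- c) y0) h1.
  have h3 := is_deriveZ (- c^-1) h2.
  apply: (@is_derive_eq _ _ _ _ _ _ _ _ h3).
  by rewrite /GRing.scale /=; field; rewrite gt_eqF.
have cF y e : 0 <= y -> {for y, continuous (fun y => (1 + y) `^ e)}.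
  move=> /pos y0; apply: (@continuous_comp _ _ _ (fun y : R => 1 + y) (fun w => w `^ e)).
    by apply: cvgD; [exact: cvg_cst | exact: cvg_id].
  exact: continuous_powR_gt0.
rewrite (@ge0_continuous_FTC2y R _ (fun y => - c^-1 * (1 + y) `^ (- c)) 0 0).
- by rewrite addr0 powR1 mulr1 -EFinB sub0r opprK.
- by move=> y _; rewrite powR_ge0.
- apply: continuous_in_subspaceT => y; rewrite inE /= in_itv /= andbT; exact: cF.
- rewrite -[X in _ --> X](mulr0 (- c^-1)); apply: cvgMr.
  apply: (@cvg_comp _ _ _ (fun y : R => 1 + y) (fun x : R => x `^ (- c)) _ +oo).
    by apply/cvgryPge => A; near=> y; rewrite addrC -lerBlDr; near: y;
      apply: nbhs_pinfty_ge; exact: num_real.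
  exact: cvgr_powRN.
- by move=> y /ltW y0; apply: ex_derive; exact: (dF _ y0).
- by apply: cvg_at_right_filter; apply: cvgMr; apply: cF.
- move=> y; rewrite in_itv /= andbT => /ltW y0.
  by rewrite derive1E (@derive_val _ _ _ _ _ _ _ (dF _ y0)).
Unshelve. all: by end_near. Qed.

(** Comparison with (1 + y)^(-c - 1), where c = q r - p > 0 is the surplus of decay at infinity;
    [p >= 1] lets y^(p - 1) be bounded by (1 + y)^(p - 1). *)
Lemma beta_integral_lty p q r : 1 <= p -> 0 < q -> p / q < r ->
  (\int[mu]_(y in `[0%R, +oo[) (y `^ (p - 1) * (1 + 1 * y `^ q) `^ (- r))%:E < +oo)%E.
Proof.
move=> p1 q0 pqr; pose c := q * r - p.
have c0 : 0 < c by rewrite subr_gt0 -ltr_pdivrMl // mulrC.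
have r0 : 0 <= r by rewrite ltW // (le_lt_trans _ pqr) // divr_ge0 ?(ltW q0) // (le_trans _ p1).
apply: (@le_lt_trans _ _ ((2 `^ (q * r))%:E *
   \int[mu]_(y in `[0%R, +oo[) ((1 + y) `^ (- c - 1))%:E)%E); last first.
  by rewrite integral_powR_shift // -EFinM ltry.
have m1 : measurable_fun `[(0 : R), +oo[ (fun y => ((1 + y) `^ (- c - 1))%:E).
  apply/measurable_EFinP/measurable_funTS; apply: (measurableT_comp (measurable_powR _)).
  exact: measurable_funD.
rewrite -ge0_integralZl //=; last by move=> x _; rewrite lee_fin powR_ge0.
apply: ge0_le_integral => //=.
- by move=> y _; rewrite lee_fin mulr_ge0 ?powR_ge0.
- by apply/measurable_EFinP; exact: measurable_beta_integrand.
- exact: measurable_funeM.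
move=> y; rewrite in_itv /= andbT => y0; rewrite -EFinM lee_fin mul1r.
have y1 : 0 < 1 + y by rewrite ltr_wpDr.
have w0 : 0 < 1 + y `^ q by rewrite ltr_wpDr ?powR_ge0.
have -> : - c - 1 = p - 1 - q * r by rewrite /c; ring.
rewrite powRB ?(gt_eqF y1) ?implybT // mulrCA; apply: ler_pM; rewrite ?powR_ge0 //.
  by apply: ge0_ler_powR; rewrite ?nnegrE ?subr_ge0 ?(ltW y1) // lerDr.
rewrite powRN -lef_pV2 ?posrE ?invr_gt0 ?divr_gt0 ?powR_gt0 // invrK invf_div.
rewrite ler_pdivrMr ?powR_gt0 // !powRrM -(@powRM _ _ _ r (ltW w0)) ?powR_ge0 // mulrC.
apply: ge0_ler_powR; rewrite ?nnegrE ?mulr_ge0 ?powR_ge0 ?(ltW w0) //.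
(* Up to the factor 2^q, (1 + y)^q is controlled by 1 + y^q, through the maximum of 1 and y. *)
apply: (@le_trans _ _ ((2 * Num.max 1 y) `^ q)).
  apply: ge0_ler_powR; rewrite ?nnegrE ?(ltW q0) ?(ltW y1) ?mulr_ge0 ?le_max ?ler01 //.
  rewrite mulr_natl mulr2n; apply: lerD; rewrite le_max lexx ?orbT //.
rewrite powRM ?le_max ?ler01 // ler_wpM2l ?powR_ge0 //.
rewrite maxEle; case: ifP => _; first by rewrite lerDr.
by rewrite powR1 lerDl powR_ge0.
Qed.

End BetaFinite.

Section BetaValue.
Context {R : realType}.
Local Notation mu := (@lebesgue_measure R).
Implicit Types (p q r d : R).

Let Beta_integral_fin p q r : 1 <= p -> 0 < q -> p / q < r ->
  (\int[mu]_(u in `[0%R, 1%R]) (u `^ (r - p / q - 1) * (1 - u) `^ (p / q - 1))%:E)%E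
  = (Beta (r - p / q) (p / q))%:E.
Proof.
move=> p1 q0 pqr; rewrite /Beta /Rintegral fineK //.
rewrite (beta_substitution _ _ q0 ltr01); apply: fin_numM => //.
rewrite ge0_fin_numE; first exact: beta_integral_lty.
by apply: integral_ge0 => u _; rewrite lee_fin mulr_ge0 ?powR_ge0.
Qed.

Lemma beta_integralE p q r d : 1 <= p -> 0 < q -> p / q < r -> 0 < d ->
  (\int[mu]_(y in `[0%R, +oo[) (y `^ (p - 1) * (1 + d * y `^ q) `^ (- r))%:E =
   (d `^ (- (p / q)) / q * Beta (r - p / q) (p / q))%:E)%E.
Proof.
move=> p1 q0 pqr d0.
have c0 : q * d `^ (p / q) != 0 by rewrite gt_eqF // mulr_gt0 ?powR_gt0.
rewrite EFinM -Beta_integral_fin // (beta_substitution _ _ q0 d0) muleA -EFinM.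
by rewrite powRN -invfM [X in X^-1]mulrC mulVf ?mul1e.
Qed.

(** The arguments keep the form r - p / q and p / q because finiteness of the integral, without
    which [Beta] would be 0, was obtained in this parametrization. *)
Lemma Beta_gt0 p q r : 1 <= p -> 0 < q -> p / q < r -> 0 < Beta (r - p / q) (p / q).
Proof.
move=> p1 q0 pqr; rewrite -lte_fin -Beta_integral_fin //.
have mG (D : set R) : measurable_fun D
    (fun u => (u `^ (r - p / q - 1) * (1 - u) `^ (p / q - 1))%:E).
  apply/measurable_EFinP/measurable_funTS; apply: measurable_funM; first exact: measurable_powR.
  by apply: (measurableT_comp (measurable_powR _)); exact: measurable_funB.
rewrite integral_itv_bndoo; last exact: mG.
apply: integral_gt0 => //.
- by rewrite [ltRHS]lebesgue_measure_itv /= lte_fin ltr01 oppr0 adde0 lte_fin.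
- exact: mG.
- move=> u /=; rewrite in_itv /= => /andP[u0 u1].
  by rewrite lte_fin mulr_gt0 ?powR_gt0 ?subr_gt0.
Qed.

End BetaValue.

(** * Tonelli and scaling on the quadrant *)

Section Quadrant.
Context {R : realType}.
Local Notation mu := (@lebesgue_measure R).
Implicit Types (f : R * R -> R).

Let quadrant_patch f x t : ((EFin \o f) \_ Kset) (x, t) =
  ((fun x => ((fun t => (f (x, t))%:E) \_ `[0%R, +oo[) t) \_ `[(0:R), +oo[) x.
Proof.
rewrite !patchE; have -> : ((x, t) \in @Kset R) = (0 <= x) && (0 <= t).
  by apply/idP/andP; rewrite inE.
have inb (y : R) : (y \in `[0%R, +oo[%classic) = (0 <= y).
  by rewrite mem_setE in_itv /= andbT.
by rewrite !inb; case: (0 <= x); case: (0 <= t).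
Qed.

Lemma integral_quadrant12 f : measurable_fun setT f -> (forall z, 0 <= f z) ->
  (\int[mu \x mu]_(z in Kset) (f z)%:E =
   \int[mu]_(x in `[0%R, +oo[) \int[mu]_(t in `[0%R, +oo[) (f (x, t))%:E)%E.
Proof.
move=> mf f0; rewrite integral_mkcond fubini_tonelli1; last 2 first.
- apply/(measurable_restrictT (EFin \o f) (@measurable_Kset R)).
  by apply/measurable_EFinP; exact: measurable_funTS.
- by move=> z; apply: erestrict_ge0 => y _; rewrite /= lee_fin.
rewrite [RHS]integral_mkcond; apply: eq_integral => x _ /=.
rewrite /fubini_F; under eq_integral do rewrite quadrant_patch patchE.
by rewrite patchE; case: ifPn => _; [rewrite [RHS]integral_mkcond | rewrite integral0].
Qed.

Lemma integral_quadrant_swap f : measurable_fun setT f -> (forall z, 0 <= f z) ->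
  (\int[mu]_(x in `[0%R, +oo[) \int[mu]_(t in `[0%R, +oo[) (f (x, t))%:E =
   \int[mu]_(t in `[0%R, +oo[) \int[mu]_(x in `[0%R, +oo[) (f (x, t))%:E)%E.
Proof.
move=> mf f0; rewrite -integral_quadrant12 // integral_mkcond fubini_tonelli2; last 2 first.
- apply/(measurable_restrictT (EFin \o f) (@measurable_Kset R)).
  by apply/measurable_EFinP; exact: measurable_funTS.
- by move=> z; apply: erestrict_ge0 => y _; rewrite /= lee_fin.
rewrite [RHS]integral_mkcond; apply: eq_integral => t _ /=.
rewrite /fubini_G; under eq_integral do rewrite quadrant_patch.
rewrite -integral_mkcond patchE; case: ifPn => tn.
  by apply: eq_integral => x _; rewrite patchE tn.
by apply: integral0_eq => x _; rewrite patchE (negbTE tn).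
Qed.

End Quadrant.

Section Scaling.
Context {R : realType}.
Local Notation mu := (@lebesgue_measure R).
Implicit Types (G : R -> R) (a k x y : R).

Lemma within_continuous_powR a : 0 <= a ->
  {within `[(0:R), +oo[, continuous (fun x => x `^ a)}.
Proof.
(* Since 0 to the power 0 is 1, the exponent 0 gives the constant 1; this case occurs for t^(2
   alpha) with alpha = 0. *)
rewrite le_eqVlt => /predU1P[<-|a0].
  by rewrite (_ : (fun x => _) = cst 1); [apply: continuous_subspaceT => x; exact: cvg_cst|
    apply/funext => x; rewrite powRr0].
apply/continuous_within_itvcyP; split; last by rewrite powR0 ?gt_eqF //; exact: powR_cvg0.
by move=> x; rewrite in_itv /= andbT; exact: continuous_powR_gt0.
Qed.

Lemma ge0_integral_scaling G k : 0 < k -> {within `[(0:R), +oo[, continuous G} ->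
  (forall x, 0 <= G x) ->
  (\int[mu]_(x in `[0%R, +oo[) (G x)%:E = \int[mu]_(x in `[0%R, +oo[) (G (k * x) * k)%:E)%E.
Proof.
move=> k0 cG G0.
have dF x : is_derive x (1 : R) (fun x => k * x) k.
  have h := is_deriveZ k (is_derive_id x (1 : R)).
  by apply: (@is_derive_eq _ _ _ _ _ _ _ _ h); rewrite /GRing.scale /= mulr1.
have F' : (fun x => k * x)^`()%classic = cst k.
  by apply/funext => x; rewrite derive1E (@derive_val _ _ _ _ _ _ _ (dF x)).
have := @increasing_ge0_integration_by_substitutiony R (fun x => k * x) G 0.
rewrite F' mulr0 => -> //.
- by move=> x y _ _ xy; rewrite ltr_pM2l.
- by move=> x _; exact: cvg_cst.
- exact: is_cvg_cst.
- exact: is_cvg_cst.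
- split; first by move=> x _; apply: ex_derive; exact: dF.
  apply: cvg_at_right_filter; apply: differentiable_continuous.
  by apply/derivable1_diffP; apply: ex_derive; exact: dF.
- by apply/cvgryPge => A; near=> x; rewrite -ler_pdivrMl //; near: x;
    apply: nbhs_pinfty_ge; exact: num_real.
Unshelve. all: by end_near. Qed.

End Scaling.

(** * The integral of the inverse weight *)

Section WeightIntegral.
Context {R : realType}.
Local Notation mu := (@lebesgue_measure R).
Variables (alpha s tau : R).
Hypotheses (alpha0 : 0 <= alpha) (s_gt : 3 * alpha + 2 < s) (tau0 : 0 < tau).
Implicit Types (x y t : R) (z : R * R).

Local Notation theta := ((3 * alpha + 2) / s).
Local Notation B1 := (Beta ((alpha + 1) / 2) ((2 * alpha + 1) / 2)).
Local Notation B2 := (Beta ((s - 3 * alpha - 2) / s) ((3 * alpha + 2) / s)).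

Definition weight z : R := 1 + tau * (hnorm z `^ s) ^+ 2.

Let s0 : 0 < s.
Proof. by apply: le_lt_trans s_gt; move: alpha0; lra. Qed.

Lemma weight_gt0 z : 0 < weight z.
Proof. by rewrite ltr_wpDr // mulr_ge0 ?sqr_ge0 // ltW. Qed.

Lemma hnormX z : (hnorm z `^ s) ^+ 2 = (z.1 ^+ 4 + 4 * z.2 ^+ 2) `^ (s / 2).
Proof.
rewrite /hnorm -powR_mulrn ?powR_ge0 // -!powRrM; congr (_ `^ _); lra.
Qed.

Lemma measurable_hnorm : measurable_fun setT (@hnorm R).
Proof.
apply: (measurableT_comp (measurable_powR _)); apply: measurable_funD.
  by apply: measurable_funX; exact: measurable_fst.
by apply: measurable_funM => //; apply: measurable_funX; exact: measurable_snd.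
Qed.

Lemma measurable_weightV : measurable_fun setT (fun z => (weight z)^-1).
Proof.
rewrite (_ : (fun z => _) = fun z => (weight z) `^ (- 1)); last first.
  by apply/funext => z; rewrite powR_inv1 // ltW // weight_gt0.
apply: (measurableT_comp (measurable_powR _)); apply: measurable_funD => //.
apply: measurable_funM => //; apply: measurable_funX.
exact: (measurableT_comp (measurable_powR _) measurable_hnorm).
Qed.

(** The integrand after t = x^2 y / 2, up to the constant [C]. Then x^4 + 4 t^2 = x^4 (1 + y^2), and
    the density with the Jacobian gives (x^2 / 2)^(2 alpha + 1) x^(2 alpha + 1), whence the exponent
    6 alpha + 3 of x and the power of 2 in [C]. *)
Let kern x y := x `^ (6 * alpha + 4 - 1) * y `^ (2 * alpha) *
   (1 + (tau * (1 + y ^+ 2) `^ (s / 2)) * x `^ (2 * s)) `^ (- 1).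

Let C := (pi * Gamma (alpha + 1))^-1 * 2 `^ (- (2 * alpha + 1)).

Let inner x : 0 < x ->
  (\int[mu]_(t in `[0%R, +oo[) (m_density alpha (x, t) / weight (x, t))%:E =
   \int[mu]_(y in `[0%R, +oo[) (C * kern x y)%:E)%E.
Proof.
move=> x0; pose k := x ^+ 2 / 2.
have k0 : 0 < k by rewrite divr_gt0 ?exprn_gt0.
have cw : continuous (fun t => (weight (x, t))^-1).
  move=> t; apply: cvgV; first by rewrite gt_eqF // weight_gt0.
  apply: cvgD; first exact: cvg_cst.
  apply: cvgMr.
  rewrite (_ : (fun t => _) = fun t => (x ^+ 4 + 4 * t ^+ 2) `^ (s / 2)); last first.
    by apply/funext => u; rewrite hnormX.
  rewrite hnormX.
  apply: (@continuous_comp _ _ _ (fun t : R => x ^+ 4 + 4 * t ^+ 2) (fun w => w `^ (s / 2))).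
    by apply: cvgD; [exact: cvg_cst | apply: cvgMr; exact: exprn_continuous].
  by apply: continuous_powR_gt0; rewrite ltr_wpDr ?exprn_gt0 // mulr_ge0 ?sqr_ge0.
rewrite (ge0_integral_scaling k0); last 2 first.
- move=> t; apply: cvgM; last exact: (continuous_subspaceT cw).
  apply: cvgMr; apply: cvgMr; apply: within_continuous_powR; move: alpha0; lra.
- by move=> t; rewrite mulr_ge0 ?m_density_ge0 // invr_ge0 ltW // weight_gt0.
apply: eq_integral => y; rewrite inE /= in_itv /= andbT => y0; congr EFin.
have w0 : 0 < 1 + y ^+ 2 by rewrite ltr_wpDr ?sqr_ge0.
have x40 : 0 <= x ^+ 4 by rewrite exprn_ge0 // ltW.
have -> : weight (x, k * y) = 1 + (tau * (1 + y ^+ 2) `^ (s / 2)) * x `^ (2 * s).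
  rewrite /weight hnormX /=.
  have -> : x ^+ 4 + 4 * (k * y) ^+ 2 = x ^+ 4 * (1 + y ^+ 2) by rewrite /k; field.
  rewrite powRM ?(ltW w0) // -(powR_mulrn 4 (ltW x0)) -powRrM.
  by rewrite -mulrA [x `^ _ * _]mulrC; congr (_ + _ * (_ * _ `^ _)); field.
rewrite /m_density /kern /C /= (powRM _ (ltW k0) y0).
rewrite powR_inv1; last by rewrite addr_ge0 // !mulr_ge0 ?powR_ge0 ?(ltW tau0).
have kE : k `^ (2 * alpha) * k = x `^ (2 * (2 * alpha + 1)) * 2 `^ (- (2 * alpha + 1)).
  rewrite -{2}(powRr1 (ltW k0)) -powRD ?(gt_eqF k0) ?implybT // /k.
  rewrite powRM ?sqr_ge0 ?invr_ge0 // -(powR_mulrn 2 (ltW x0)) -powRrM.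
  by rewrite -powR_inv1 // -powRrM mulN1r.
have xE : x `^ (6 * alpha + 4 - 1) = x `^ (2 * alpha + 1) * x `^ (2 * (2 * alpha + 1)).
  by rewrite -powRD ?(gt_eqF x0) ?implybT //; congr (_ `^ _); ring.
rewrite xE; move: kE; set k2 := 2 `^ _; set X2 := x `^ (2 * _) => kE.
transitivity ((pi * Gamma (alpha + 1))^-1 * x `^ (2 * alpha + 1) * y `^ (2 * alpha) *
  (k `^ (2 * alpha) * k) / (1 + tau * (1 + y ^+ 2) `^ (s / 2) * x `^ (2 * s))); first by ring.
by rewrite kE; ring.
Qed.

Let measurable_kern : measurable_fun setT (fun z => C * kern z.1 z.2).
Proof.
have m1 c : measurable_fun setT (fun z : R * R => z.1 `^ c).
  exact: (measurableT_comp (measurable_powR _) measurable_fst).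
have m2 c : measurable_fun setT (fun z : R * R => z.2 `^ c).
  exact: (measurableT_comp (measurable_powR _) measurable_snd).
apply: measurable_funM => //; apply: measurable_funM; first exact: measurable_funM.
apply: (measurableT_comp (measurable_powR _)); apply: measurable_funD => //.
apply: measurable_funM => //; apply: measurable_funM => //.
apply: (measurableT_comp (measurable_powR _)); apply: measurable_funD => //.
by apply: measurable_funX; exact: measurable_snd.
Qed.

Lemma integral_weight :
  (\int[mu \x mu]_(z in Kset) (m_density alpha z / weight z)%:E =
   ((tau `^ (- theta)) * (B1 * B2 / (pi * Gamma (alpha + 1) * 4 `^ (alpha + 1) * (2 * s))))%:E)%E.
Proof.
have C0 : 0 <= C by rewrite mulr_ge0 ?powR_ge0 // invr_ge0 mulr_ge0 ?pi_ge0 // Gamma_ge0.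
have kern0 x y : 0 <= kern x y by rewrite !mulr_ge0 ?powR_ge0.
rewrite integral_quadrant12; last 2 first.
- by apply: measurable_funM; [exact: measurable_m_density | exact: measurable_weightV].
- by move=> z; rewrite mulr_ge0 ?m_density_ge0 // invr_ge0 ltW // weight_gt0.
transitivity (\int[mu]_(x in `[0%R, +oo[) \int[mu]_(y in `[0%R, +oo[) (C * kern x y)%:E)%E.
  apply: eq_integral => x; rewrite inE /= in_itv /= andbT le_eqVlt.
  (* The substitution degenerates at x = 0, where both integrands vanish because x carries a
     positive exponent. *)
  move=> /predU1P[<-|/inner //].
  rewrite !integral0_eq // => y _; first by rewrite /kern powR0 ?mul0r ?mulr0 //; move: alpha0; lra.
  by rewrite /m_density powR0 ?mul0r ?mulr0 ?mul0r //=; move: alpha0; lra.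
(* Integrating in x first, for fixed y, gives a Beta integral with d = tau (1 + y^2)^(s/2). It
   leaves d^(- theta), and since (s/2) theta = (3 alpha + 2) / 2 no longer involves s, the integral
   in y is a second Beta integral. *)
rewrite (@integral_quadrant_swap _ (fun z => C * kern z.1 z.2)) //; last first.
  by move=> z; rewrite mulr_ge0.
pose D := tau `^ (- theta) / (2 * s) * B2.
transitivity (\int[mu]_(y in `[0%R, +oo[)
  ((C * D)%:E * (y `^ (2 * alpha + 1 - 1) * (1 + 1 * y `^ 2) `^ (- ((3 * alpha + 2) / 2)))%:E))%E.
  apply: eq_integral => y; rewrite inE /= in_itv /= andbT => y0.
  have w0 : 0 < 1 + y ^+ 2 by rewrite ltr_wpDr ?sqr_ge0.
  have d0 : 0 < tau * (1 + y ^+ 2) `^ (s / 2) by rewrite mulr_gt0 ?powR_gt0.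
  have q0 : 0 < 2 * s by rewrite mulr_gt0.
  have thE : (6 * alpha + 4) / (2 * s) = theta by field; rewrite gt_eqF.
  have th1 : theta < 1 by rewrite ltr_pdivrMr // mul1r.
  transitivity ((C * y `^ (2 * alpha))%:E * \int[mu]_(x in `[0%R, +oo[)
    (x `^ (6 * alpha + 4 - 1) *
     (1 + (tau * (1 + y ^+ 2) `^ (s / 2)) * x `^ (2 * s)) `^ (- 1))%:E)%E.
    rewrite -ge0_integralZl //=; last 3 first.
    - by apply/measurable_EFinP; exact: measurable_beta_integrand.
    - by move=> x _; rewrite lee_fin mulr_ge0 ?powR_ge0.
    - by rewrite lee_fin mulr_ge0 ?powR_ge0.
    by apply: eq_integral => x _; rewrite -EFinM; congr EFin; rewrite /kern; ring.
  rewrite beta_integralE // ?thE //; last by move: alpha0; lra.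
  rewrite -!EFinM; congr EFin.
  have -> : 1 - theta = (s - 3 * alpha - 2) / s by field; rewrite gt_eqF.
  rewrite /D (powRM _ (ltW tau0)) ?powR_ge0 // -powRrM mul1r addrK powR_mulrn //.
  have -> : s / 2 * - theta = - ((3 * alpha + 2) / 2) by field; rewrite gt_eqF.
  by ring.
rewrite ge0_integralZl //=; last 3 first.
- by apply/measurable_EFinP; exact: measurable_beta_integrand.
- by move=> y _; rewrite lee_fin mulr_ge0 ?powR_ge0.
- rewrite lee_fin mulr_ge0 // /D !mulr_ge0 ?powR_ge0 ?invr_ge0 ?mulr_ge0 ?(ltW s0) //.
  by apply: Rintegral_ge0 => u _; rewrite mulr_ge0 ?powR_ge0.
rewrite beta_integralE //; last 2 first.
- by move: alpha0; lra.
- by move: alpha0; lra.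
rewrite powR1 -EFinM; congr EFin.
have -> : (3 * alpha + 2) / 2 - (2 * alpha + 1) / 2 = (alpha + 1) / 2 by field.
(* The power of 4 collects 2^(- (2 alpha + 1)) from [C] and the factor 1/2 of the Beta integral in
   y. *)
have -> : 4 `^ (alpha + 1) = 2 `^ (2 * alpha + 1) * 2 :> R.
  have -> : 4 = 2 ^+ 2 :> R by rewrite expr2 -natrM.
  rewrite -powR_mulrn // -powRrM -[X in _ = _ * X](powRr1 (ler0n _ 2)) -powRD ?pnatr_eq0 ?implybT //.
  by congr (_ `^ _); ring.
have p20 : 2 `^ (2 * alpha + 1) != 0 :> R by rewrite gt_eqF // powR_gt0.
have pi0 : pi != 0 :> R by rewrite gt_eqF // pi_gt0.
have G0 : Gamma (alpha + 1) != 0 :> R by rewrite gt_eqF // Gamma_gt0 // ltr_wpDl.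
have s1 : s != 0 by rewrite gt_eqF.
rewrite /D /C powRN; move: (pi : R) pi0 => P P0; field.
by rewrite p20 P0 G0 s1.
Qed.

End WeightIntegral.

(** * Integration against a measure given by a density *)

Section Density.
Import HBNNSimple.
Local Open Scope ereal_scope.
Context d1 d2 (X : measurableType d1) (Y : measurableType d2) (R : realType).
Variables (phi : X -> Y) (mu : {measure set X -> \bar R}) (nu : {measure set Y -> \bar R}).
Variables (K : set X) (g : X -> R).
Hypotheses (mphi : measurable_fun setT phi) (mK : measurable K).
Hypotheses (mg : measurable_fun setT g) (g0 : forall z, (0 <= g z)%R).
Hypothesis nuE :
  forall A, measurable A -> nu A = \int[mu]_(x in phi @^-1` A `&` K) (g x)%:E.

Let nnsfun_density (h : {nnsfun Y >-> R}) :
  \int[nu]_y (h y)%:E = \int[mu]_(x in K) ((h (phi x))%:E * (g x)%:E).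
Proof.
rewrite integralT_nnsfun sintegralE.
have mgK : measurable_fun K (fun z => (g z)%:E).
  by apply/measurable_EFinP; exact: measurable_funTS.
have mpre (A : set Y) : measurable A -> measurable (phi @^-1` A).
  by move=> mA; rewrite -[X in measurable X]setTI; exact: mphi.
transitivity (\sum_(r \in range h) \int[mu]_(x in K)
    ((r * \1_(h @^-1` [set r]) (phi x))%:E * (g x)%:E)).
  apply: eq_fsbigr => r; rewrite inE => -[y _ hy].
  have r0 : (0 <= r)%R by rewrite -hy.
  rewrite nuE //= integral_mkcondl -ge0_integralZl //=; last 2 first.
  - apply/measurable_restrict => //; first by apply: mpre.
    by apply/measurable_EFinP; exact: measurable_funTS.
  - by move=> x _; apply: erestrict_ge0 => w _; rewrite lee_fin.
  apply: eq_integral => x _; rewrite EFinM -muleA; congr (_ * _).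
  rewrite patchE indicE; case: ifPn; rewrite ?inE /= => hx.
    by rewrite mem_set ?mul1e.
  by rewrite memNset ?mul0e // => hx'; move: hx; rewrite mem_set.
rewrite -ge0_integral_fsum //; last 2 first.
- move=> r; apply: emeasurable_funM => //.
  apply/measurable_EFinP/measurable_funTS; apply: measurable_funM => //.
  exact: measurableT_comp.
- by move=> r x _; rewrite mule_ge0 ?lee_fin ?g0 //; exact: nnfun_muleindic_ge0.
apply: eq_integral => x _.
rewrite -ge0_mule_fsuml => [|r]; last exact: nnfun_muleindic_ge0.
by rewrite fsumEFin // -fimfunE.
Qed.

(** The measure is given only by its values on sets, in [nuE]; simple functions follow by linearity,
    and nonnegative functions by monotone convergence. *)
Lemma ge0_integral_density (f : Y -> \bar R) : measurable_fun setT f ->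
  (forall y, 0 <= f y) -> \int[nu]_y f y = \int[mu]_(x in K) (f (phi x) * (g x)%:E).
Proof.
move=> mf f0; pose h := nnsfun_approx measurableT mf.
have cf y : (h n y)%:E @[n --> \oo] --> f y by exact: cvg_nnsfun_approx.
have nd y : {homo (fun n => h n y) : m n / (m <= n)%N >-> (m <= n)%R}.
  by move=> m n mn; exact/lefP/nd_nnsfun_approx.
transitivity (limn (fun n => \int[nu]_y (h n y)%:E)).
  rewrite -monotone_convergence //.
  - by apply: eq_integral => y _; apply/esym/cvg_lim => //; exact: cf.
  - by move=> n; exact/measurable_EFinP.
  - by move=> n y _; rewrite lee_fin.
  - by move=> y _ m n mn; rewrite lee_fin nd.
rewrite (funext (fun n => nnsfun_density (h n))) -monotone_convergence //.
- apply: eq_integral => x _; apply/cvg_lim => //.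
  by apply: cvgeZr => //; exact: cf.
- move=> n; apply: emeasurable_funM; apply/measurable_EFinP; apply: measurable_funTS => //.
  exact: measurableT_comp.
- by move=> n x _; rewrite mule_ge0 ?lee_fin.
- by move=> x _ m n mn; rewrite lee_wpmul2r ?lee_fin ?nd.
Qed.

End Density.

(** * Complex-valued integrals and the pointwise bound on the transform *)

Section ComplexIntegral.
Context d (T : measurableType d) (R : realType).
Variable mu : {measure set T -> \bar R}.
Local Notation normc := ComplexField.Normc.normc.
Implicit Types (f : T -> R[i]) (D : set T).

Lemma normc_sqr (z : R[i]) : normc z ^+ 2 = complex.Re z ^+ 2 + complex.Im z ^+ 2.
Proof. by case: z => a b; rewrite /= sqr_sqrtr // addr_ge0 ?sqr_ge0. Qed.

Lemma normc_ge0 (z : R[i]) : 0 <= normc z.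
Proof. by case: z => a b; rewrite /= sqrtr_ge0. Qed.

Lemma normc_real (x : R) : normc x%:C = `|x|.
Proof. by rewrite /= expr0n addr0 sqrtr_sqr. Qed.

Lemma normr_Re_le (z : R[i]) : `|complex.Re z| <= normc z.
Proof.
rewrite -ler_sqr ?nnegrE ?normc_ge0 // normc_sqr real_normK ?num_real //.
by rewrite lerDl sqr_ge0.
Qed.

Lemma normr_Im_le (z : R[i]) : `|complex.Im z| <= normc z.
Proof.
rewrite -ler_sqr ?nnegrE ?normc_ge0 // normc_sqr real_normK ?num_real //.
by rewrite lerDr sqr_ge0.
Qed.

Lemma measurable_normc f : cmeasurable_fun f -> measurable_fun setT (fun x => normc (f x)).
Proof.
move=> [mre mim].
rewrite (_ : (fun x => _) =
  fun x => (complex.Re (f x) ^+ 2 + complex.Im (f x) ^+ 2) `^ 2^-1); last first.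
  apply/funext => x; rewrite powR12_sqrt ?addr_ge0 ?sqr_ge0 //.
  by rewrite -normc_sqr sqrtr_sqr ger0_norm // normc_ge0.
apply: (measurableT_comp (measurable_powR _)).
by apply: measurable_funD; exact: measurable_funX.
Qed.

Lemma cLnorm1E f : cLnorm mu 1%:E f = (\int[mu]_x (normc (f x))%:E)%E.
Proof.
rewrite /cLnorm Lnorm1; apply: eq_integral => x _.
by rewrite gee0_abs // lee_fin normc_ge0.
Qed.

Lemma cLnorm2E f : cLnorm mu 2%:E f = ((\int[mu]_x (normc (f x) ^+ 2)%:E) `^ 2^-1)%E.
Proof.
rewrite /cLnorm unlock; congr (_ `^ _)%E; apply: eq_integral => x _.
by rewrite gee0_abs ?lee_fin ?normc_ge0 // poweR_EFin powR_mulrn // normc_ge0.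
Qed.

(** With I the integral, |I|^2 is the integral of Re(conj(I) f), which is at most |I| |f| pointwise;
    dividing by |I| concludes when I is nonzero. *)
Lemma normc_cintegral_le D f : measurable D -> cmeasurable_fun f ->
  (\int[mu]_(x in D) (normc (f x))%:E < +oo)%E ->
  ((normc (cintegral mu D f))%:E <= \int[mu]_(x in D) (normc (f x))%:E)%E.
Proof.
move=> mD mf foo; have [mre mim] := mf.
have mn : measurable_fun D (fun x => normc (f x)).
  by apply: measurable_funTS; exact: measurable_normc.
have inorm : mu.-integrable D (EFin \o (fun x => normc (f x))).
  apply/integrableP; split; first exact/measurable_EFinP.
  by under eq_integral do rewrite gee0_abs ?lee_fin ?normc_ge0 //.
have ire : mu.-integrable D (EFin \o (fun x => complex.Re (f x))).
  apply: le_integrable inorm => //; first exact/measurable_EFinP/measurable_funTS.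
  by move=> x _ /=; rewrite lee_fin (ger0_norm (normc_ge0 _)) normr_Re_le.
have iim : mu.-integrable D (EFin \o (fun x => complex.Im (f x))).
  apply: le_integrable inorm => //; first exact/measurable_EFinP/measurable_funTS.
  by move=> x _ /=; rewrite lee_fin (ger0_norm (normc_ge0 _)) normr_Im_le.
have iZ r (g : T -> R) : mu.-integrable D (EFin \o g) ->
    mu.-integrable D (EFin \o (fun x => r * g x)).
  by move=> ig; have := integrableZl mD r ig.
set I := cintegral mu D f.
have -> : (\int[mu]_(x in D) (normc (f x))%:E =
    (\int[mu]_(x in D) normc (f x))%:E)%E.
  by rewrite /Rintegral fineK // integrable_fin_num.
rewrite lee_fin; have [I0|I0] := eqVneq (normc I) 0.
  by rewrite I0; apply: Rintegral_ge0 => x _; exact: normc_ge0.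
have Ipos : 0 < normc I by rewrite lt_neqAle eq_sym I0 normc_ge0.
rewrite -(ler_pM2l Ipos) -expr2 normc_sqr !expr2 -!RintegralZl //.
rewrite -RintegralD //; last 2 first.
- exact: iZ.
- exact: iZ.
apply: le_Rintegral => //.
- by have := integrableD mD (iZ (complex.Re I) _ ire) (iZ (complex.Im I) _ iim).
- exact: iZ.
move=> x _.
rewrite -[leRHS]ger0_norm ?mulr_ge0 ?normc_ge0 //.
apply: le_trans (ler_norm _) _.
rewrite -ler_sqr ?nnegrE // !real_normK ?num_real // exprMn !normc_sqr.
(* Lagrange's identity: the defect in the planar Cauchy-Schwarz inequality is a square. *)
rewrite -subr_ge0 [X in 0 <= X](_ : _ = (complex.Re I * complex.Im (f x) -
  complex.Im I * complex.Re (f x)) ^+ 2) ?sqr_ge0 //; ring.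
Qed.

End ComplexIntegral.

Section TransformBound.
Local Opaque Gamma.
Context {R : realType}.
Variable alpha : R.
Hypothesis alpha0 : 0 <= alpha.
Local Notation normc := ComplexField.Normc.normc.
Implicit Types (f : R * R -> R[i]) (p : R * nat) (z : R * R).

Lemma LB_kernel_le1 p z : Khat p -> Kset z -> `|LB_kernel alpha p z| <= 1.
Proof.
move=> p0 [x0 t0]; rewrite /LB_kernel normrM -[leRHS]mulr1; apply: ler_pM => //.
  by apply: bessel_j_le1; move: alpha0; lra.
by apply: laguerre_fun_le1 => //; rewrite mulr_ge0 ?sqr_ge0.
Qed.

Lemma measurable_LB_kernel p : measurable_fun setT (LB_kernel alpha p).
Proof.
apply: measurable_funM.
  apply: (@measurableT_comp _ _ _ _ _ _ (bessel_j (alpha - 2^-1))).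
    apply: continuous_measurable_fun; apply: continuous_bessel_j; move: alpha0; lra.
  by apply: measurable_funM => //; exact: measurable_snd.
apply: (@measurableT_comp _ _ _ _ _ _ (laguerre_fun alpha p.2)).
  apply: continuous_measurable_fun => x; apply: cvgMl; apply: cvgM.
    apply: (@continuous_comp _ _ _ (fun x : R => - (x / 2)) expR); last exact: continuous_expR.
    by apply: continuousN; exact: cvgMl.
  exact: continuous_horner.
by apply: measurable_funM => //; apply: measurable_funX; exact: measurable_fst.
Qed.

Lemma normc_LB1_le f p : Khat p -> cmeasurable_fun f ->
  (\int[m_alpha alpha]_z (normc (f z))%:E < +oo)%E ->
  ((normc (LB1 alpha f p))%:E <= \int[m_alpha alpha]_z (normc (f z))%:E)%E.
Proof.
move=> p0 mf foo; have [mre mim] := mf.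
have mn := measurable_normc mf; have mK := measurable_LB_kernel p.
have ReE z : complex.Re (f z * (LB_kernel alpha p z)%:C) = complex.Re (f z) * LB_kernel alpha p z.
  by case: (f z) => a b /=; rewrite mulr0 subr0.
have ImE z : complex.Im (f z * (LB_kernel alpha p z)%:C) = complex.Im (f z) * LB_kernel alpha p z.
  by case: (f z) => a b /=; rewrite mulr0 add0r.
have mF : cmeasurable_fun (fun z => f z * (LB_kernel alpha p z)%:C).
  split; [rewrite (funext ReE) | rewrite (funext ImE)]; exact: measurable_funM.
have nE z : Kset z -> normc (f z * (LB_kernel alpha p z)%:C) <= normc (f z).
  move=> Kz; rewrite ComplexField.Normc.normcM normc_real.
  by rewrite ler_piMr ?normc_ge0 // LB_kernel_le1.
have le1 : (\int[m_alpha alpha]_(z in Kset) (normc (f z * (LB_kernel alpha p z)%:C))%:E <=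
    \int[m_alpha alpha]_z (normc (f z))%:E)%E.
  apply: (@le_trans _ _ (\int[m_alpha alpha]_(z in Kset) (normc (f z))%:E)%E).
    apply: ge0_le_integral => //=.
    - exact: measurable_Kset.
    - by move=> z _; rewrite lee_fin normc_ge0.
    - by apply/measurable_EFinP/measurable_funTS; exact: measurable_normc.
    - by apply/measurable_EFinP/measurable_funTS.
  apply: ge0_subset_integral => //.
  - exact: measurable_Kset.
  - exact/measurable_EFinP.
  - by move=> z _; rewrite lee_fin normc_ge0.
apply: (le_trans (normc_cintegral_le (@measurable_Kset R) mF _) le1).
exact: le_lt_trans le1 foo.
Qed.

End TransformBound.

(** * Optimised weighted bound for the L^1 norm *)

Section Optimisation.
Context {R : realType}.
Implicit Types (N a b K theta P Q : R).

(** Recovers the product form of Cauchy-Schwarz from its additive form: the choice e = Q / N makes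
    the last term equal to N. *)
Lemma sqr_le_of_AMGM N P Q : 0 <= N -> 0 < P -> 0 < Q ->
  (forall e, 0 < e -> 2 * N <= e * P + e^-1 * Q) -> N ^+ 2 <= P * Q.
Proof.
rewrite le_eqVlt => /predU1P[<- P0 Q0 _|N0 P0 Q0 H].
  by rewrite expr0n mulr_ge0 // ltW.
have := H (Q / N) (divr_gt0 Q0 N0); rewrite invf_div divfK ?gt_eqF // => h.
have : N <= Q / N * P by lra.
by rewrite mulrAC ler_pdivlMr // mulrC [Q * P]mulrC.
Qed.

Lemma optimise_weights N a b K theta : 0 <= N -> 0 < a -> 0 < b -> 0 < K ->
  0 < theta -> theta < 1 ->
  (forall e tau, 0 < e -> 0 < tau ->
     2 * N <= e * (a + tau * b) + e^-1 * (tau `^ (- theta) * K)) ->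
  N ^+ 2 <= K / (1 - theta) * ((1 - theta) / theta) `^ theta * a `^ (1 - theta) * b `^ theta.
Proof.
move=> N0 a0 b0 K0 th0 th1 H.
have th1' : 0 < 1 - theta by rewrite subr_gt0.
pose rho := (1 - theta) / theta; have rho0 : 0 < rho by rewrite divr_gt0.
(* The minimizer of (a + tau b) tau^(- theta): the critical point satisfies tau b = theta (a + tau
   b). *)
pose tau := a / (rho * b); have tau0 : 0 < tau by apply: divr_gt0 => //; exact: mulr_gt0.
have P0 : 0 < a + tau * b by apply: addr_gt0 => //; exact: mulr_gt0.
have Q0 : 0 < tau `^ (- theta) * K by apply: mulr_gt0 => //; exact: powR_gt0.
apply: (le_trans (sqr_le_of_AMGM N0 P0 Q0 (fun e e0 => H e tau e0 tau0))).
have -> : a + tau * b = a / (1 - theta).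
  by rewrite /tau /rho; field; rewrite ?gt_eqF.
have -> : tau `^ (- theta) = rho `^ theta * b `^ theta * a `^ (- theta).
  have rb0 : 0 < rho * b by exact: mulr_gt0.
  rewrite /tau (powRM _ (ltW a0)) ?invr_ge0 ?(ltW rb0) //.
  rewrite -(powR_inv1 (ltW rb0)) -powRrM mulrNN mul1r.
  by rewrite (powRM _ (ltW rho0) (ltW b0)) mulrC.
have -> : a `^ (1 - theta) = a * a `^ (- theta).
  by rewrite powRD ?(gt_eqF a0) ?implybT // powRr1 // ltW.
by rewrite le_eqVlt -/rho; apply/orP; left; apply/eqP; ring.
Qed.

End Optimisation.

Section L1Estimate.
Local Opaque Gamma Beta.
Context {R : realType}.
Local Notation mu := (@lebesgue_measure R).
Variables (alpha s : R).
Hypotheses (alpha0 : 0 <= alpha) (s_gt : 3 * alpha + 2 < s).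
Local Notation theta := ((3 * alpha + 2) / s).
Local Notation m := (m_alpha alpha).
Implicit Types (phi : R * R -> R) (z : R * R) (e tau : R).

(** The integral of the inverse weight at tau = 1; by homogeneity a general tau only contributes
    tau^(- theta). *)
Definition weight_const : R :=
  Beta ((alpha + 1) / 2) ((2 * alpha + 1) / 2) *
  Beta ((s - 3 * alpha - 2) / s) ((3 * alpha + 2) / s) /
  (pi * Gamma (alpha + 1) * 4 `^ (alpha + 1) * (2 * s)).

Let s0 : 0 < s.
Proof. by apply: le_lt_trans s_gt; move: alpha0; lra. Qed.

Let theta0 : 0 < theta.
Proof. by rewrite divr_gt0 //; move: alpha0; lra. Qed.

Let theta1 : theta < 1.
Proof. by rewrite ltr_pdivrMr // mul1r. Qed.

Let Beta1_gt0 : 0 < Beta ((alpha + 1) / 2) ((2 * alpha + 1) / 2).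
Proof.
have -> : (alpha + 1) / 2 = (3 * alpha + 2) / 2 - (2 * alpha + 1) / 2 by field.
by apply: Beta_gt0 => //; move: alpha0; lra.
Qed.

Let Beta2_gt0 : 0 < Beta ((s - 3 * alpha - 2) / s) theta.
Proof.
have -> : (s - 3 * alpha - 2) / s = 1 - theta by field; rewrite gt_eqF.
have -> : theta = (6 * alpha + 4) / (2 * s) by field; rewrite gt_eqF.
apply: Beta_gt0; first by move: alpha0; lra.
  by rewrite mulr_gt0.
by rewrite ltr_pdivrMr ?mulr_gt0 // mul1r; move: s_gt; lra.
Qed.

Lemma weight_const_gt0 : 0 < weight_const.
Proof.
have G0 : 0 < Gamma (alpha + 1) by apply: Gamma_gt0; move: alpha0; lra.
by rewrite divr_gt0 ?mulr_gt0 ?pi_gt0 ?powR_gt0.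
Qed.

(* [M_const alpha s ^+ 2] is twice the sharp constant, which is why the inequality
   of the theorem is strict. *)
Lemma M_constE : M_const alpha s =
  (2 * (weight_const / (1 - theta) * ((1 - theta) / theta) `^ theta)) `^ (1 / 2).
Proof.
rewrite /M_const /weight_const.
have -> : (1 - theta) / theta = (s - 3 * alpha - 2) / (3 * alpha + 2).
  by field; rewrite !gt_eqF //; move: alpha0; lra.
congr (_ `^ _); set P := _ `^ theta.
have pi0 : (pi : R) != 0 by rewrite gt_eqF // pi_gt0.
have G0 : Gamma (alpha + 1) != 0 by rewrite gt_eqF // Gamma_gt0 //; move: alpha0; lra.
have F0 : 4 `^ (alpha + 1) != 0 :> R by rewrite gt_eqF // powR_gt0.
have d1 : s - (3 * alpha + 2) != 0 by rewrite gt_eqF // subr_gt0.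
have s1 : s != 0 by rewrite gt_eqF.
move: (pi : R) (Gamma (alpha + 1)) (4 `^ (alpha + 1)) pi0 G0 F0 => p G F p0 G0 F0.
move: (Beta _ _) (Beta _ _) => b1 b2; field.
by rewrite p0 G0 F0 s1 d1.
Qed.

Lemma M_const_gt0 : 0 < M_const alpha s.
Proof.
have th1 : 0 < 1 - theta by rewrite subr_gt0.
rewrite M_constE; apply: powR_gt0; apply: mulr_gt0 => //; apply: mulr_gt0.
  by apply: divr_gt0 => //; exact: weight_const_gt0.
by apply: powR_gt0; exact: divr_gt0.
Qed.

(* The measurable structures on [R * R] underlying [mu \x mu] and [m_alpha] carry
   different displays, hence the identity map between them. *)
Lemma ge0_integral_m_alpha (f : R * R -> \bar R) : measurable_fun setT f ->
  (forall z, (0 <= f z)%E) ->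
  (\int[m]_z f z = \int[mu \x mu]_(z in Kset) (f z * (m_density alpha z)%:E))%E.
Proof.
move=> mf f0.
pose phi (z : measurableTypeR R * measurableTypeR R) : (R * R)%type := z.
have mphi : measurable_fun setT phi by move=> _ Y mY; rewrite setTI; exact mY.
apply: (@ge0_integral_density _ _ _ (R * R)%type R phi (mu \x mu)%E) => //.
- exact: measurable_Kset.
- exact: measurable_m_density.
- exact: m_density_ge0.
Qed.

Lemma integral_weightV tau : 0 < tau ->
  (\int[m]_z ((weight s tau z)^-1)%:E = (tau `^ (- theta) * weight_const)%:E)%E.
Proof.
move=> tau0; rewrite ge0_integral_m_alpha.
- rewrite -(integral_weight alpha0 s_gt tau0).
  by apply: eq_integral => z _; rewrite -EFinM mulrC.
- by apply/measurable_EFinP; exact: measurable_weightV.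
- by move=> z; rewrite lee_fin invr_ge0 ltW // weight_gt0.
Qed.

(** The additive form of Cauchy-Schwarz is the integral of a pointwise inequality, hence meaningful
    for infinite integrals: integrability of phi becomes a consequence. *)
Lemma L1_weighted_bound phi e tau : measurable_fun setT phi -> (forall z, 0 <= phi z) ->
  0 < e -> 0 < tau ->
  (2%:E * \int[m]_z (phi z)%:E <=
   e%:E * (\int[m]_z (phi z ^+ 2)%:E +
           tau%:E * \int[m]_z ((hnorm z `^ s * phi z) ^+ 2)%:E) +
   (e^-1 * (tau `^ (- theta) * weight_const))%:E)%E.
Proof.
move=> mphi phi0 e0 tau0.
have m1 : measurable_fun setT (fun z => (phi z ^+ 2)%:E).
  by apply/measurable_EFinP; exact: measurable_funX.
have m2 : measurable_fun setT (fun z => ((hnorm z `^ s * phi z) ^+ 2)%:E).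
  apply/measurable_EFinP; apply: measurable_funX; apply: measurable_funM => //.
  exact: (measurableT_comp (measurable_powR _) (@measurable_hnorm R)).
have m3 : measurable_fun setT (fun z => ((weight s tau z)^-1)%:E).
  by apply/measurable_EFinP; exact: measurable_weightV.
have w0 z := weight_gt0 s tau0 z.
have p2 z : (0 <= (phi z ^+ 2)%:E)%E by rewrite lee_fin sqr_ge0.
have ph2 z : (0 <= ((hnorm z `^ s * phi z) ^+ 2)%:E)%E by rewrite lee_fin sqr_ge0.
have pw z : (0 <= ((weight s tau z)^-1)%:E)%E by rewrite lee_fin invr_ge0 ltW.
have e1 : (0 <= e%:E)%E by rewrite lee_fin ltW.
have t1 : (0 <= tau%:E)%E by rewrite lee_fin ltW.
have ei1 : (0 <= (e^-1)%:E)%E by rewrite lee_fin invr_ge0 ltW.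
have pt2 z : (0 <= tau%:E * ((hnorm z `^ s * phi z) ^+ 2)%:E)%E by exact: mule_ge0.
have mt2 : measurable_fun setT (fun z => (tau%:E * ((hnorm z `^ s * phi z) ^+ 2)%:E)%E).
  exact: measurable_funeM.
have msum : measurable_fun setT
    (fun z => ((phi z ^+ 2)%:E + tau%:E * ((hnorm z `^ s * phi z) ^+ 2)%:E)%E).
  exact: emeasurable_funD.
rewrite EFinM -integral_weightV //.
rewrite -(ge0_integralZl _ _ m2) // -(ge0_integralD _ _ _ m1) // -(ge0_integralZl _ _ msum) //;
  last by move=> z _; exact: adde_ge0.
rewrite -(ge0_integralZl _ _ m3) // -ge0_integralD //; last 4 first.
- by move=> z _; rewrite mule_ge0 // adde_ge0.
- exact: measurable_funeM.
- by move=> z _; rewrite mule_ge0.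
- exact: measurable_funeM.
rewrite -ge0_integralZl //; last 2 first.
- exact/measurable_EFinP.
- by move=> z _; rewrite lee_fin.
apply: ge0_le_integral => //.
- by move=> z _; rewrite mule_ge0 ?lee_fin.
- by apply: measurable_funeM; exact/measurable_EFinP.
- by apply: emeasurable_funD; exact: measurable_funeM.
move=> z _; rewrite -!(EFinM, EFinD) lee_fin.
have wE : weight s tau z = 1 + tau * (hnorm z `^ s) ^+ 2 by [].
(* With W the weight, 2 phi <= e phi^2 W + 1 / (e W), and the difference is (e phi W - 1)^2 / (e
   W). *)
rewrite -subr_ge0 [X in 0 <= X](_ : _ =
  e^-1 * (weight s tau z)^-1 * (e * phi z * weight s tau z - 1) ^+ 2).
  by apply: mulr_ge0; [apply: mulr_ge0; rewrite invr_ge0 ltW | exact: sqr_ge0].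
have w1 := w0 z; rewrite wE in w1 *; field.
by rewrite !gt_eqF.
Qed.

End L1Estimate.

(** * Nonvanishing of the norms, restriction to E, and the final inequality *)

Section Main.
Local Opaque Gamma Beta.
Context {R : realType}.
Variables (alpha s : R).
Hypotheses (alpha0 : 0 <= alpha) (s_gt : 3 * alpha + 2 < s).
Local Notation theta := ((3 * alpha + 2) / s).
Local Notation m := (m_alpha alpha).
Local Notation gam := (gamma_alpha alpha).
Local Notation normc := ComplexField.Normc.normc.
Implicit Types (f : R * R -> R[i]) (F : R * nat -> R[i]) (E : set (R * nat)).

Let s0 : 0 < s.
Proof. by apply: le_lt_trans s_gt; move: alpha0; lra. Qed.

Let theta0 : 0 < theta.
Proof. by rewrite divr_gt0 //; move: alpha0; lra. Qed.

Let theta1 : theta < 1.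
Proof. by rewrite ltr_pdivrMr // mul1r. Qed.

Lemma integral_normc_sqr_gt0 d (T : measurableType d) (mu : {measure set T -> \bar R})
    (h : T -> R[i]) : cmeasurable_fun h -> ~ {ae mu, forall z, h z = 0} ->
  (0 < \int[mu]_z (normc (h z) ^+ 2)%:E)%E.
Proof.
move=> mh h0; rewrite lt0e integral_ge0 ?andbT; last by move=> z _; rewrite lee_fin sqr_ge0.
apply/eqP => I0; apply: h0.
have mn : measurable_fun setT (fun z => (normc (h z) ^+ 2)%:E).
  by apply/measurable_EFinP; apply: measurable_funX; exact: measurable_normc.
have : (\int[mu]_z `|(normc (h z) ^+ 2)%:E| = 0)%E.
  rewrite -[RHS]I0; apply: eq_integral => z _.
  by rewrite gee0_abs // lee_fin sqr_ge0.
move=> /(ae_eq_integral_abs mu measurableT mn); apply: filterS => z /(_ I) /eqP.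
rewrite eqe sqrf_eq0 => /eqP; exact: ComplexField.Normc.eq0_normc.
Qed.

Lemma hnorm_eq0 (z : R * R) : hnorm z = 0 -> z = (0, 0).
Proof.
case: z => x t /eqP; rewrite powR_eq0 => /andP[/eqP /=].
have x0 : 0 <= x ^+ 4 by rewrite -[4%N]/(2 * 2)%N exprM sqr_ge0.
have t0 : 0 <= 4 * t ^+ 2 by rewrite mulr_ge0 ?sqr_ge0.
move=> h _; have hx : x ^+ 4 = 0 by lra. have ht : 4 * t ^+ 2 = 0 by lra.
move/eqP: hx; rewrite expf_eq0 /= => /eqP ->.
by move/eqP: ht; rewrite mulf_eq0 pnatr_eq0 /= sqrf_eq0 => /eqP ->.
Qed.

Lemma ae_neq_origin : {ae m, forall z, z <> (0, 0)}.
Proof.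
exists [set (0, 0)]; split.
- rewrite (_ : [set (0, 0)] = [set 0] `*` [set 0]); first exact: measurableX.
  by apply/seteqP; split => -[x t] /= [-> ->].
- rewrite /m_alpha; apply: integral0_eq => -[x t] [/= [-> _] _].
  by rewrite /m_density powR0 ?mul0r ?mulr0 //=; move: alpha0; lra.
- by move=> z /= /contrapT.
Qed.

Lemma cmeasurable_hnormM f : cmeasurable_fun f ->
  cmeasurable_fun (fun z => (hnorm z `^ s)%:C * f z).
Proof.
have mw : measurable_fun setT (fun z : R * R => hnorm z `^ s).
  exact: (measurableT_comp (measurable_powR _) (@measurable_hnorm R)).
move=> [mre mim]; split.
- rewrite (_ : (fun z => _) = fun z => hnorm z `^ s * complex.Re (f z)).
    exact: measurable_funM.
  by apply/funext => z; case: (f z) => a b /=; rewrite mul0r subr0.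
- rewrite (_ : (fun z => _) = fun z => hnorm z `^ s * complex.Im (f z)).
    exact: measurable_funM.
  by apply/funext => z; case: (f z) => a b /=; rewrite mul0r addr0.
Qed.

Lemma normc_hnormM f z : normc ((hnorm z `^ s)%:C * f z) = hnorm z `^ s * normc (f z).
Proof. by rewrite ComplexField.Normc.normcM normc_real ger0_norm ?powR_ge0. Qed.

(** The weight vanishes only at the origin, a null set. This makes the weighted norm of f strictly
    positive, without which the right-hand side could be 0. *)
Lemma weighted_not_ae0 f : ~ {ae m, forall z, f z = 0} ->
  ~ {ae m, forall z, (hnorm z `^ s)%:C * f z = 0}.
Proof.
move=> f0 h; apply: f0; move: h ae_neq_origin; apply: filterS2 => z h z0.
apply: ComplexField.Normc.eq0_normc; apply/eqP.
have := normc_hnormM f z; rewrite h ComplexField.Normc.normc0 => /esym/eqP.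
rewrite mulf_eq0 => /orP[|//]; rewrite powR_eq0 => /andP[/eqP/hnorm_eq0 //].
Qed.

Lemma cmeasurable_indicM F E : measurable E -> cmeasurable_fun F ->
  cmeasurable_fun (fun p => F p * (\1_E p)%:C).
Proof.
move=> mE [mre mim]; split.
- rewrite (_ : (fun p => _) = fun p => complex.Re (F p) * \1_E p).
    exact: measurable_funM.
  by apply/funext => p; case: (F p) => a b /=; rewrite mulr0 subr0.
- rewrite (_ : (fun p => _) = fun p => complex.Im (F p) * \1_E p).
    exact: measurable_funM.
  by apply/funext => p; case: (F p) => a b /=; rewrite mulr0 add0r.
Qed.

Lemma normc_indicM F E p : normc (F p * (\1_E p)%:C) = normc (F p) * \1_E p.
Proof. by rewrite ComplexField.Normc.normcM normc_real ger0_norm. Qed.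

Lemma sqr_integral_indicM_le F E (N : R) : measurable E -> cmeasurable_fun F ->
  0 <= N -> {ae gam, forall p, E p -> normc (F p) <= N} ->
  (\int[gam]_p (normc (F p * (\1_E p)%:C) ^+ 2)%:E <= (N ^+ 2)%:E * gam E)%E.
Proof.
move=> mE mF N0 FN.
have -> : ((N ^+ 2)%:E * gam E = \int[gam]_p ((N ^+ 2)%:E * (\1_E p)%:E))%E.
  rewrite ge0_integralZl //; last by rewrite lee_fin sqr_ge0.
    by rewrite integral_indic // setIT.
  exact/measurable_EFinP.
apply: ae_ge0_le_integral => //.
- by move=> p _; rewrite lee_fin sqr_ge0.
- apply/measurable_EFinP; apply: measurable_funX; apply: measurable_normc.
  exact: cmeasurable_indicM.
- by move=> p _; rewrite mule_ge0 // lee_fin sqr_ge0.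
- by apply: measurable_funeM; exact/measurable_EFinP.
apply: filterS FN => p Hp _; rewrite normc_indicM -EFinM lee_fin indicE.
case: (boolP (p \in E)) => [|_]; last by rewrite !mulr0 expr0n.
by rewrite inE !mulr1 => /Hp Fp; rewrite lerXn2r ?nnegrE ?normc_ge0.
Qed.

(** Serves the case of an infinite weighted norm, where the strict inequality says that the
    left-hand side is finite. *)
Lemma cLnorm2_indicM_lty F E : measurable E -> in_Lp gam 2%:E F ->
  (cLnorm gam 2%:E (fun p => (F p * (\1_E p)%:C)%R) < +oo)%E.
Proof.
move=> mE [mF]; rewrite !cLnorm2E => /lty_poweRy => /(_ (invr_neq0 _)) h.
apply: poweR_lty; apply: le_lt_trans (h _) => //.
apply: ge0_le_integral => //.
- by move=> p _; rewrite lee_fin sqr_ge0.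
- apply/measurable_EFinP; apply: measurable_funX; apply: measurable_normc.
  exact: cmeasurable_indicM.
- by apply/measurable_EFinP; apply: measurable_funX; exact: measurable_normc.
move=> p _; rewrite lee_fin normc_indicM lerXn2r ?nnegrE ?mulr_ge0 ?normc_ge0 //.
by rewrite ler_piMr ?normc_ge0 // indicE; case: (_ \in _).
Qed.

(* The Cauchy--Schwarz step: [f] is integrable with [N = ||f||_1] bounded by the
   sharp constant. *)
Lemma integral_normc_bound f (a b : R) : cmeasurable_fun f -> 0 < a -> 0 < b ->
  (\int[m]_z (normc (f z) ^+ 2)%:E = a%:E)%E ->
  (\int[m]_z ((hnorm z `^ s * normc (f z)) ^+ 2)%:E = b%:E)%E ->
  exists N, [/\ 0 <= N, (\int[m]_z (normc (f z))%:E = N%:E)%E &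
    N ^+ 2 <= weight_const alpha s / (1 - theta) * ((1 - theta) / theta) `^ theta *
              a `^ (1 - theta) * b `^ theta].
Proof.
move=> mf a0 b0 aE bE.
have mphi := measurable_normc mf.
have phi0 z : 0 <= normc (f z) by exact: normc_ge0.
have H e tau (e0 : 0 < e) (tau0 : 0 < tau) :=
  L1_weighted_bound alpha0 s_gt mphi phi0 e0 tau0.
pose I := (\int[m]_z (normc (f z))%:E)%E.
have I0 : (0 <= I)%E by apply: integral_ge0 => z _; rewrite lee_fin.
have Ifin : I \is a fin_num.
  rewrite ge0_fin_numE //.
  (* Any fixed pair of parameters bounds twice the L^1 norm by a finite number, which proves
     integrability before optimisation. *)
  have := H 1 1 ltr01 ltr01; rewrite aE bE -!(EFinM, EFinD) -/I.
  case: I I0 => [r||] //; first by move=> _ _; rewrite ltry.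
  by rewrite gt0_muley ?lte_fin.
exists (fine I); split; [exact: fine_ge0 | by rewrite fineK | ].
apply: optimise_weights => //; first exact: fine_ge0.
  exact: weight_const_gt0.
move=> e tau e0 tau0; have := H e tau e0 tau0.
by rewrite aE bE -/I -(fineK Ifin) -!(EFinM, EFinD) lee_fin.
Qed.

End Main.

Theorem theorem4p2 (R : realType) (alpha s : R)
    (halpha : 0 <= alpha) (hs : 3 * alpha + 2 < s)
    (f : R * R -> R[i]) (hf : in_Lp (m_alpha alpha) 2%:E f)
    (hf0 : ~ {ae m_alpha alpha, forall z, f z = 0})
    (E : set (R * nat)) (mE : measurable E) (hE : E `<=` Khat)
    (hE0 : (0 < gamma_alpha alpha E)%E)
    (hEoo : (gamma_alpha alpha E < +oo)%E) :
  (cLnorm (gamma_alpha alpha) 2%:E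
     (fun p => (LB2 alpha f p * (\1_E p)%:C)%R)
   < (M_const alpha s)%:E
     * gamma_alpha alpha E `^ (1 / 2)
     * cLnorm (m_alpha alpha) 2%:E f `^ (1 - (3 * alpha + 2) / s)
     * cLnorm (m_alpha alpha) 2%:E (fun z => ((hnorm z `^ s)%:C * f z)%R)
         `^ ((3 * alpha + 2) / s))%E.
Proof.
have s0 : 0 < s by apply: le_lt_trans hs; lra.
have th0 : 0 < (3 * alpha + 2) / s by rewrite divr_gt0 //; lra.
have th1 : (3 * alpha + 2) / s < 1 by rewrite ltr_pdivrMr // mul1r.
have [fm foo] := hf.
have Mpos := M_const_gt0 halpha hs.
have MsqrE := M_constE halpha hs.
have wc0 := weight_const_gt0 halpha hs.
have N_exists := integral_normc_bound halpha hs fm.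
set theta := (3 * alpha + 2) / s in th0 th1 MsqrE N_exists *.
set A : \bar R := (\int[m_alpha alpha]_z (ComplexField.Normc.normc (f z) ^+ 2)%:E)%E.
set B : \bar R :=
  (\int[m_alpha alpha]_z ((hnorm z `^ s * ComplexField.Normc.normc (f z)) ^+ 2)%:E)%E.
have fE : cLnorm (m_alpha alpha) 2%:E f = (A `^ 2^-1)%E by rewrite cLnorm2E.
have wE : cLnorm (m_alpha alpha) 2%:E (fun z => ((hnorm z `^ s)%:C * f z)%R) = (B `^ 2^-1)%E.
  rewrite cLnorm2E; congr (_ `^ _)%E; apply: eq_integral => z _.
  by rewrite normc_hnormM.
have A0 : (0 < A)%E by exact: integral_normc_sqr_gt0.
have B0 : (0 < B)%E.
  have := integral_normc_sqr_gt0 (cmeasurable_hnormM s fm) (weighted_not_ae0 halpha hf0).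
  by under eq_integral do rewrite normc_hnormM.
have Aoo : (A < +oo)%E by move: foo; rewrite fE => /lty_poweRy; apply; rewrite invr_eq0.
rewrite fE wE.
have [a a0 aE] : exists2 a : R, 0 < a & A = a%:E.
  by move: A0 Aoo; case eA: A => [r||] //; rewrite lte_fin => r0 _; exists r.
have [g g0 gE] : exists2 g : R, 0 < g & gamma_alpha alpha E = g%:E.
  by move: hE0 hEoo; case: (gamma_alpha alpha E) => [r||] //; rewrite lte_fin => r0 _; exists r.
rewrite aE gE !poweR_EFin -!EFinM.
set c : R := _ * _ * _.
have c0 : 0 < c.
  apply: mulr_gt0; first by apply: mulr_gt0 => //; exact: powR_gt0.
  by apply: powR_gt0; exact: powR_gt0.
(* Valid also for B = +oo. Against the default value 0 of [LB2] the strict inequality reduces to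
   this positivity. *)
have RHS0 : (0 < c%:E * (B `^ 2^-1) `^ theta)%E.
  rewrite mule_gt0 ?lte_fin // poweR_gt0 // poweR_gt0 //.
have [ex_T|no_T] := pselect (exists T, continuous_L2_extension alpha T); last first.
  rewrite /LB2 xgetPN; last by move=> T HT; apply: no_T; exists T.
  rewrite cLnorm2E (_ : (\int[_]_x _)%E = 0%E).
    by rewrite poweR0r.
  apply: integral0_eq => p _.
  by rewrite mul0r ComplexField.Normc.normc0 expr0n.
have [T_L2 T_L1 _] := xgetPex (fun _ _ => 0) ex_T; rewrite -/(LB2 alpha) in T_L2 T_L1.
have LBf := T_L2 _ hf.
have [Boo|Boo] := eqVneq B +oo%E.
  rewrite Boo !poweRyr ?invr_eq0 ?(gt_eqF th0) // gt0_muley ?lte_fin //.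
  exact: cLnorm2_indicM_lty.
have [b b0 bE] : exists2 b : R, 0 < b & B = b%:E.
  by move: B0 Boo; case eB: B => [r||] //; rewrite lte_fin => r0 _; exists r.
have [N [N0 IN N2]] := N_exists a b a0 b0 aE bE.
(* Integrability of f is what gives access to the integral formula. The formula holds only almost
   everywhere, and so does the bound; on E, contained in [Khat], the argument of the Laguerre
   function is nonnegative. *)
have fL1 : in_Lp (m_alpha alpha) 1%:E f by split=> //; rewrite cLnorm1E IN ltry.
have bound : {ae gamma_alpha alpha, forall p, E p -> ComplexField.Normc.normc (LB2 alpha f p) <= N}.
  apply: filterS (T_L1 _ fL1 hf) => p -> Ep.
  rewrite -lee_fin -IN; apply: normc_LB1_le => //; first exact: hE.
  by rewrite IN ltry.
have := sqr_integral_indicM_le mE LBf.1 N0 bound; rewrite gE -EFinM => le_g.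
rewrite bE cLnorm2E.
apply: (@le_lt_trans _ _ (((N ^+ 2 * g)%:E) `^ 2^-1)%E).
  apply: gt0_ler_poweR => //; rewrite ?invr_ge0 // in_itv /= ?leey ?andbT.
    by apply: integral_ge0 => p _; rewrite lee_fin sqr_ge0.
  by rewrite lee_fin mulr_ge0 ?sqr_ge0 // ltW.
rewrite !poweR_EFin -EFinM lte_fin /c MsqrE.
set Q := _ / (1 - theta) * _ in N2 *.
have Q0 : 0 < Q.
  by apply: mulr_gt0; [apply: divr_gt0 | apply: powR_gt0; apply: divr_gt0]; rewrite ?subr_gt0.
have D0 : 0 < Q * a `^ (1 - theta) * b `^ theta.
  by apply: mulr_gt0; [apply: mulr_gt0 => // |]; exact: powR_gt0.
(* Strictness enters here: N^2 is at most a positive quantity, hence less than its double, and the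
   factor 2 is the one contained in [M_const]. *)
apply: (@lt_le_trans _ _ ((2 * (Q * a `^ (1 - theta) * b `^ theta) * g) `^ 2^-1)).
  apply: gt0_ltr_powR; rewrite ?invr_gt0 ?nnegrE //.
  - by rewrite mulr_ge0 ?sqr_ge0 // ltW.
  - by rewrite ltW // mulr_gt0 // mulr_gt0.
  - rewrite ltr_pM2r //; apply: (le_lt_trans N2); lra.
move: Q Q0 {N2 D0} => Q /ltW Q0.
rewrite div1r -[(a `^ 2^-1) `^ _]powRAC -[(b `^ 2^-1) `^ _]powRAC.
rewrite -!powRM ?mulr_ge0 ?powR_ge0 ?(ltW g0) //.
rewrite le_eqVlt; apply/orP; left; apply/eqP; congr (_ `^ _); ring.
Qed.
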